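(* Let $d=1$, fix $\varepsilon>0$, and let the initial configuration have law $\pi_1$ (all arrows, including the one in the hand, i.i.d. uniform on $\{-1,+1\}$). For both the $\mathrm{M1}_\varepsilon$ and the $\mathrm{M2}_\varepsilon$ models, let $E(t)=\mathbb{E}[|X_t|^2]$ be the mean-square displacement of the walker and $\widehat E(\lambda)=\int_0^\infty E(t)e^{-\lambda t}\,dt$. Then there are constants $C,D>0$ (which may depend on $\varepsilon$) such that $$C\lambda^{-9/4}\le\widehat E(\lambda)\le D\lambda^{-5/2}$$ for all sufficiently small $\lambda>0$.
   Context: Let $\mathbb{Z}_\star=\mathbb{Z}\cup\{\star\}$, where $\star$ is an extra symbol indexing the arrow in the walker's hand, $\mathcal{E}=\{-1,+1\}$, $\Omega=\mathcal{E}^{\mathbb{Z}_\star}$. For $\omega\in\Omega$, $\omega(x)$ is the arrow at displacement $x$ from the walker and $\omega(\star)$ is the hand arrow. Maps on $\Omega$: for $e\in\mathcal{E}$, $\tau_e\omega(x)=\omega(x+e)$ for $x\neq\star$ and $\tau_e\omega(\star)=\omega(\star)$; $\tau_\star\omega(x)=\omega(x+\omega(\star))$ for $x\ne\star$ and $\tau_\star\omega(\star)=\omega(\star)$; the swap $\sigma$ exchanges the values at $0$ and $\star$ and leaves the others unchanged. For a step map $\tau$ put $$T[\tau]f(\omega)=f(\sigma\tau\omega)-f(\omega),\qquad \widetilde T[\tau]f(\omega)=\tfrac14 f(\tau\omega)+\tfrac14 f(\sigma\tau\omega)+\tfrac14 f(\tau\sigma\omega)+\tfrac14 f(\sigma\tau\sigma\omega)-f(\omega).$$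 Let $U=\frac12\sum_{e\in\mathcal{E}}\widetilde T[\tau_e]$. The $\mathrm{M1}_\varepsilon$ (resp. $\mathrm{M2}_\varepsilon$) model is the continuous-time jump process $(\eta_t)_{t\ge0}$ on $\Omega$ (environment seen from the walker) with generator $G_\varepsilon=T[\tau_\star]+\varepsilon U$ (resp. $\widetilde G_\varepsilon=\widetilde T[\tau_\star]+\varepsilon U$). The position $X_t$ of the walker starts at $X_0=0$ and changes whenever a step map is applied: by $e$ when $\tau_e$ is applied, and when $\tau_\star$ is applied, by the arrow in the hand at the moment it is applied (i.e. $\omega(\star)$ in the terms $\tau_\star\omega,\sigma\tau_\star\omega$, and $\omega(0)$ in the terms $\tau_\star\sigma\omega,\sigma\tau_\star\sigma\omega$). Expectations are over the initial configuration and the dynamics. *)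

(* Defs.v *)
From HB Require Import structures.
From mathcomp Require Import all_boot all_order all_algebra.
From mathcomp Require Import all_classical all_reals all_analysis.

Set Implicit Arguments.
Unset Strict Implicit.
Unset Printing Implicit Defensive.
Import Order.TTheory GRing.Theory Num.Theory.
Import numFieldNormedType.Exports.

Local Open Scope classical_set_scope.
Local Open Scope ring_scope.

HB.instance Definition _ := isPointed.Build int 0.
HB.instance Definition _ := @isMeasurable.Build default_measure_display
  int discrete_measurable discrete_measurable0
  discrete_measurableC discrete_measurableU.

Section markov_jump_process.
Local Open Scope ereal_scope.
Context {R : realType} {dS : measure_display} {S : measurableType dS}.
Implicit Types (p : R -> R.-pker S ~> S) (L : (S -> R) -> S -> R).

(* All time parameters range over [0, +oo[; values at negative times are
   irrelevant. *)
Definition transition_semigroup p :=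
  (forall z B, measurable B -> p 0%R z B = \d_z B) /\
  (forall s t z B, (0 <= s)%R -> (0 <= t)%R -> measurable B ->
    p (s + t)%R z B = \int[p s z]_y p t y B).

(* Infinitesimal generator, in the supremum norm, on all bounded measurable
   functions (the jump rates considered here are bounded). *)
Definition has_generator p L :=
  forall f : S -> R, measurable_fun [set: S] f ->
    [bounded f z | z in [set: S]] ->
  forall e : R, (0 < e)%R -> \forall h \near 0%R^'+,
    forall z, (`|h^-1 * (\int[p h z]_y f y - f z) - L f z| <= e)%R.

Context {d : measure_display} {T : measurableType d}.
Implicit Types (P : probability T R) (Z : R -> T -> S).

Definition past Z (s : R) : set (set T) :=
  <<s \bigcup_(u in `[0%R, s]) g_sigma_algebra_preimage (Z u) >>.

Definition markov_property P p Z :=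
  forall (s t : R) (A : set T) (B : set S), (0 <= s)%R -> (0 <= t)%R ->
    past Z s A -> measurable B ->
  P (A `&` Z (s + t)%R @^-1` B) = \int[P]_(w in A) p t (Z s w) B.

(* Right-continuous step functions with finitely many jumps in every bounded
   time interval. *)
Definition jump_paths Z :=
  forall (w : T) (t : R), (0 <= t)%R ->
    (\forall s \near t^'+, Z s w = Z t w) /\
    ((0 < t)%R -> exists z, \forall s \near t^'-, Z s w = z).

Definition markov_jump_process P L Z :=
  [/\ forall t, (0 <= t)%R -> measurable_fun [set: T] (Z t),
      jump_paths Z &
      exists p, [/\ transition_semigroup p, has_generator p L &
                    markov_property P p Z]].

End markov_jump_process.

(* The arrows -1 and +1 are encoded by false and true. *)
Definition arrow (b : bool) : int := if b then 1 else -1.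

(* Z_star is [option int]: [Some x] is the displacement x, [None] the hand. *)
Definition cylinders : set (set (option int -> bool)) :=
  [set A | exists x b, A = [set w | w x = b]].

Definition config := g_sigma_algebraType cylinders.

HB.instance Definition _ := Measurable.on config.

Definition shift (k : int) (w : config) : config :=
  fun x => if x is Some y then w (Some (y + k)) else w None.

Definition step (e : bool) (w : config) : config := shift (arrow e) w.

Definition hand_step (w : config) : config := shift (arrow (w None)) w.

Definition swap (w : config) : config :=
  fun x => if x == Some 0 then w None else
           if x == None then w (Some 0) else w x.

Inductive model := M1 | M2.

(* The generators are written for an arbitrary state space carrying the swap
   and step maps: they are used on configurations, and on pairs of a
   configuration and a position. *)
Section generators.
Context {R : realType} {S : Type}.
Variables (sw : S -> S) (st : bool -> S -> S) (hst : S -> S).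
Implicit Types (tau : S -> S) (f : S -> R).

Definition opT tau f (z : S) : R := f (sw (tau z)) - f z.

Definition opTtilde tau f (z : S) : R :=
  4^-1 * f (tau z) + 4^-1 * f (sw (tau z)) + 4^-1 * f (tau (sw z))
  + 4^-1 * f (sw (tau (sw z))) - f z.

Definition opU f (z : S) : R := 2^-1 * \sum_(e : bool) opTtilde (st e) f z.

Definition generator (m : model) (eps : R) f (z : S) : R :=
  match m with M1 => opT hst f z | M2 => opTtilde hst f z end
  + eps * opU f z.

End generators.

Definition env_generator {R : realType} (m : model) (eps : R) :
  (config -> R) -> config -> R := generator swap step hand_step m eps.

(* The walker's position moves with each step map that is applied, by the arrow
   in the hand of the configuration to which that map is applied. *)
Definition walk_step (e : bool) (z : config * int) : config * int :=
  (step e z.1, z.2 + arrow e).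

Definition walk_hand_step (z : config * int) : config * int :=
  (hand_step z.1, z.2 + arrow (z.1 None)).

Definition walk_swap (z : config * int) : config * int := (swap z.1, z.2).

Definition walk_generator {R : realType} (m : model) (eps : R) :
    (config * int -> R) -> config * int -> R :=
  generator walk_swap walk_step walk_hand_step m eps.

Lemma walk_generator_fst {R : realType} (m : model) (eps : R)
    (f : config -> R) (z : config * int) :
  walk_generator m eps (fun y => f y.1) z = env_generator m eps f z.1.
Proof. by []. Qed.

Section walk.
Context {R : realType} {d : measure_display} {T : measurableType d}.
Variable P : probability T R.

Definition iid_uniform (eta0 : T -> config) :=
  forall (s : seq (option int)) (b : option int -> bool), uniq s ->
    P [set w | forall x, x \in s -> eta0 w x = b x]
    = ((2^-1 : R) ^+ size s)%:E.

Definition walk_process (m : model) (eps : R)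
    (eta : R -> T -> config) (X : R -> T -> int) :=
  [/\ iid_uniform (eta 0),
      forall w, X 0 w = 0 &
      markov_jump_process P (walk_generator m eps)
        (fun t w => (eta t w, X t w))].

Definition mean_square_displacement (X : R -> T -> int) (t : R) : \bar R :=
  'E_P[fun w => (`|X t w| ^+ 2)%:~R].

Definition laplace_msd (X : R -> T -> int) (lam : R) : \bar R :=
  (\int[lebesgue_measure]_(t in `[0%R, +oo[)
    (mean_square_displacement X t * (expR (- (lam * t)))%:E))%E.

End walk.

(* Main.v *)
Require Import Defs.
From HB Require Import structures.
From mathcomp Require Import all_boot all_order all_algebra.
From mathcomp Require Import all_classical all_reals all_analysis.
From mathcomp Require Import measurable_realfun ring lra zify.

(** Put lam = s^4.  Observed at an independent exponential time of rate lam,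
    the pair (environment, position) has a law nu satisfying
    E_nu[lam g - L g] = lam E_mu[g(.,0)], where mu is the i.i.d. uniform law
    ([resolvent_identity]).  Let psi solve lam psi - G psi = drift.  For
    g = x^2 + 2 x psi everything that grows linearly in the position x cancels
    in L g, and what remains is
    lam E_nu[x^2] = 1 + eps + 2 E_mu[b psi], where b is the drift of the
    time-reversed walk ([second_moment_formula]).  Since the Laplace transform
    of the mean-square displacement is E_nu[x^2] / lam, the theorem amounts to
    c / s <= 1 + eps + 2 E_mu[b psi] <= C / s^2 ([drift_bounds]).

    These two bounds are Hilbert space estimates in L^2(mu).  All the maps of
    the model preserve mu, so the jump part of the generator is a contraction
    and the environment part is symmetric.  Write e_x for the arrow at x, e_*
    for the arrow in the hand, phi = (e_* + e_0) / 2, and let psi solve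
    lam psi - G psi = phi.  Pairing this equation with psi shows that
    Q = <phi, psi> dominates lam |psi|^2 + eps D(psi), where the Dirichlet form
    D controls both the gradient of psi under translations and its defect of
    invariance under the swap ([energy_le]).

    Upper bound: the translates of e_0 are orthonormal, hence their sum over n
    sites has norm only sqrt n; moving e_0 over n = s^-2 sites at the price of
    the gradient of psi gives s^2 Q^2 <= K Q ([translate_trace], [upper_bound]).

    Lower bound: pair the resolvent equation with the vector
    f = l e_* + sum of (l - |x|) e_x, for l = s^-3 ([lower_bound]).  It pairs
    with phi to l, it is invariant under the swap, and shifting it by the hand
    arrow creates only a second difference, of norm sqrt l, and products of
    e_* with the arrows at distance at most l.  After a swap these products
    become products of two arrows on the line, whose translates are again
    orthogonal, so that the trace inequality bounds their pairing with psi.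

    For M2 drift and reversed drift both equal phi.  For M1 they are phi + d and
    phi - d with d = (e_* - e_0) / 2.  As the swap maps d to - d, the Dirichlet
    form sees d directly and its contribution stays of order 1 / eps;
    the mixed terms are related by the symmetry of the dynamics under swap and
    reflection ([hand_bound]). *)

Set Implicit Arguments.
Unset Strict Implicit.
Unset Printing Implicit Defensive.
Import Order.TTheory GRing.Theory Num.Theory.
Import numFieldNormedType.Exports.

Local Open Scope classical_set_scope.
Local Open Scope ring_scope.

(** * The Hilbert space of observables *)

(** What the estimates use of L^2 of the i.i.d. uniform law.  Composition with the
    swap, the reflection x -> - x, the translation by +1 or -1 and the shift by
    plus or minus the hand arrow act as the isometries [sw], [rf], [tr] and [hd]
    ([hd true] is the hand step); [ar] is a single arrow and [pr] a product of
    two.  In [hd_ar] the hand arrow h is +1 or -1, so e_(x - h) is the average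
    of e_(x - 1) and e_(x + 1) plus h times half their difference. *)
Record arrow_space (R : realFieldType) := ArrowSpace {
  obs :> lmodType R;
  ip : obs -> obs -> R;
  ipC : forall f g, ip f g = ip g f;
  ipDl : forall f g k, ip (f + g) k = ip f k + ip g k;
  ipZl : forall a f k, ip (a *: f) k = a * ip f k;
  ip_ge0 : forall f, 0 <= ip f f;
  sw : {linear obs -> obs};
  rf : {linear obs -> obs};
  tr : bool -> {linear obs -> obs};
  hd : bool -> {linear obs -> obs};
  ip_sw : forall f g, ip (sw f) (sw g) = ip f g;
  ip_rf : forall f g, ip (rf f) (rf g) = ip f g;
  ip_tr : forall b f g, ip (tr b f) (tr b g) = ip f g;
  ip_hd : forall b f g, ip (hd b f) (hd b g) = ip f g;
  swK : involutive sw;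
  rfK : involutive rf;
  trK : forall b, cancel (tr b) (tr (~~ b));
  hdK : forall b, cancel (hd b) (hd (~~ b));
  rf_sw : forall f, rf (sw f) = sw (rf f);
  rf_tr : forall b f, rf (tr b f) = tr (~~ b) (rf f);
  rf_hd : forall b f, rf (hd b f) = hd (~~ b) (rf f);
  ar : option int -> obs;
  pr : option int -> option int -> obs;
  sw_ar0 : sw (ar None) = ar (Some 0);
  sw_ar : forall x, x != 0 -> sw (ar (Some x)) = ar (Some x);
  rf_arN : rf (ar None) = ar None;
  rf_ar : forall x, rf (ar (Some x)) = ar (Some (- x));
  tr_arN : forall b, tr b (ar None) = ar None;
  tr_ar : forall b x, tr b (ar (Some x)) = ar (Some (x + (if b then 1 else -1)));
  hd_arN : forall b, hd b (ar None) = ar None;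
  hd_ar : forall x, hd false (ar (Some x)) =
    2^-1 *: (ar (Some (x - 1)) + ar (Some (x + 1)))
    + 2^-1 *: (pr None (Some (x - 1)) - pr None (Some (x + 1)));
  sw_pr : forall x, x != 0 -> sw (pr None (Some x)) = pr (Some 0) (Some x);
  rf_pr : forall x, rf (pr None (Some x)) = pr None (Some (- x));
  tr_pr : forall x y, tr true (pr (Some x) (Some y)) = pr (Some (x + 1)) (Some (y + 1));
  ip_ar : forall x y, ip (ar x) (ar y) = (x == y)%:R;
  ip_prN : forall x y, ip (pr None (Some x)) (pr None (Some y)) = (x == y)%:R;
  ip_pr : forall x y x' y', x < y -> x' < y' ->
    ip (pr (Some x) (Some y)) (pr (Some x') (Some y')) = ((x == x') && (y == y'))%:R
}.

Section inner_product.
Context (R : realFieldType) (V : arrow_space R).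
Implicit Types f g k : V.

Lemma ipDr f g k : ip k (f + g) = ip k f + ip k g.
Proof. by rewrite ipC ipDl !(ipC k). Qed.

Lemma ipZr a f k : ip k (a *: f) = a * ip k f.
Proof. by rewrite ipC ipZl ipC. Qed.

Lemma ipNl f k : ip (- f) k = - ip f k.
Proof. by rewrite -scaleN1r ipZl mulN1r. Qed.

Lemma ipNr f k : ip k (- f) = - ip k f.
Proof. by rewrite ipC ipNl ipC. Qed.

Lemma ip0l k : ip 0 k = 0.
Proof. by rewrite -(scale0r (0 : V)) ipZl mul0r. Qed.

Definition ipE := (ipDl, ipDr, ipNl, ipNr, ipZl, ipZr).

Lemma ip_suml (I : Type) (r : seq I) (P : pred I) (F : I -> V) k :
  ip (\sum_(i <- r | P i) F i) k = \sum_(i <- r | P i) ip (F i) k.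
Proof. by elim/big_rec2: _ => [|i y1 y2 _ <-]; rewrite ?ip0l ?ipDl. Qed.

Lemma ip_sumr (I : Type) (r : seq I) (P : pred I) (F : I -> V) k :
  ip k (\sum_(i <- r | P i) F i) = \sum_(i <- r | P i) ip k (F i).
Proof. by rewrite ipC ip_suml; apply: eq_bigr => i _; rewrite ipC. Qed.

Definition nrm f : R := ip f f.

Lemma nrm_ge0 f : 0 <= nrm f. Proof. exact: ip_ge0. Qed.

Lemma cauchy_schwarz f g : ip f g ^+ 2 <= nrm f * nrm g.
Proof.
have := nrm_ge0 g; rewrite le_eqVlt => /orP[/eqP g0|g0].
- rewrite -g0 mulr0.
  have H a : 0 <= nrm f + 2 * a * ip f g.
    have := nrm_ge0 (f + a *: g).
    by rewrite {1}/nrm !ipE -/(nrm f) -/(nrm g) -g0 (ipC g f); lra.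
  have [->|x0] := eqVneq (ip f g) 0; first by rewrite expr0n.
  have := H (- (nrm f + 1) / (2 * ip f g)).
  have -> : 2 * (- (nrm f + 1) / (2 * ip f g)) * ip f g = - (nrm f + 1) by field.
  by move=> h; exfalso; lra.
- have := nrm_ge0 (nrm g *: f - ip f g *: g).
  have -> : nrm (nrm g *: f - ip f g *: g) =
      nrm g * (nrm f * nrm g - ip f g ^+ 2).
    by rewrite /nrm !ipE (ipC g f); ring.
  by rewrite pmulr_rge0// subr_ge0.
Qed.

Lemma nrmD_le f g : nrm (f + g) <= 2 * nrm f + 2 * nrm g.
Proof.
have := nrm_ge0 (f - g); rewrite /nrm !ipE (ipC g f); lra.
Qed.

Lemma nrmN f : nrm (- f) = nrm f.
Proof. by rewrite /nrm !ipE opprK. Qed.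

Lemma nrmZ a f : nrm (a *: f) = a ^+ 2 * nrm f.
Proof. by rewrite /nrm ipZl ipZr mulrA. Qed.

Lemma ip_le_nrm f g : 2 * ip f g <= nrm f + nrm g.
Proof. have := nrm_ge0 (f - g); rewrite /nrm !ipE (ipC g f); lra. Qed.

Lemma sqr_sum_le (n : nat) (x : nat -> R) :
  (\sum_(i < n) x i) ^+ 2 <= n%:R * \sum_(i < n) x i ^+ 2.
Proof.
elim: n => [|n IHn]; first by rewrite !big_ord0 mulr0 expr0n.
rewrite !big_ord_recr /=; set a := \sum_(i < n) x i in IHn *.
set b := \sum_(i < n) x i ^+ 2 in IHn *; set y := x n.
have H : 2 * a * y <= b + n%:R * y ^+ 2.
  have [n0|n0] := eqVneq n 0%N.
    rewrite /a /b; subst n; rewrite !big_ord0; lra.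
  have n1 : 0 < n%:R :> R by rewrite ltr0n lt0n.
  rewrite -(ler_pM2l n1).
  apply: (@le_trans _ _ (a ^+ 2 + (n%:R * y) ^+ 2)).
    by have := sqr_ge0 (a - n%:R * y); nra.
  by rewrite mulrDr; have := IHn; nra.
rewrite -natr1; nra.
Qed.

Lemma nrm_sum_le (n : nat) (F : nat -> V) :
  nrm (\sum_(i < n) F i) <= n%:R * \sum_(i < n) nrm (F i).
Proof.
elim: n => [|n IHn]; first by rewrite !big_ord0 mulr0 /nrm ip0l.
rewrite !big_ord_recr /=; set a := \sum_(i < n) F i in IHn *.
set b := \sum_(i < n) nrm (F i) in IHn *; set y := F n.
have H : 2 * ip a y <= b + n%:R * nrm y.
  have [n0|n0] := eqVneq n 0%N.
    by rewrite /a /b; subst n; rewrite !big_ord0 ip0l; lra.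
  have n1 : 0 < n%:R :> R by rewrite ltr0n lt0n.
  rewrite -(ler_pM2l n1).
  have := ip_le_nrm a (n%:R *: y); rewrite /nrm !ipE -/(nrm a) -/(nrm y); nra.
rewrite -natr1 /nrm !ipE -/(nrm a) -/(nrm y) (ipC y a); nra.
Qed.

Lemma nrm_sum_orthogonal (n : nat) (P : nat -> V) (kappa : R) :
  (forall i j, ip (P i) (P j) = kappa * (i == j)%:R) ->
  nrm (\sum_(i < n) P i) = n%:R * kappa.
Proof.
move=> oP; rewrite /nrm ip_suml.
under eq_bigr => i _ do rewrite ip_sumr.
have E (i : 'I_n) : \sum_(j < n) ip (P i) (P j) = kappa.
  rewrite (bigD1 i)//= oP eqxx mulr1 big1 ?addr0// => j ji.
  by rewrite oP eq_sym (negbTE ji : (j : nat) == i = false) mulr0.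
under eq_bigr => i _ do rewrite E.
rewrite sumr_const card_ord.
by rewrite mulr_natl.
Qed.

End inner_product.

Section energy.
Context (R : realFieldType) (V : arrow_space R).
Implicit Types f g : V.

Lemma ip_swC f g : ip (sw V f) g = ip f (sw V g).
Proof. by rewrite -{1}(swK g) ip_sw. Qed.

Lemma ip_rfC f g : ip (rf V f) g = ip f (rf V g).
Proof. by rewrite -{1}(rfK g) ip_rf. Qed.

Lemma trNK b : cancel (tr V (~~ b)) (tr V b).
Proof. by move=> f; have := @trK _ V (~~ b) f; rewrite negbK. Qed.

Lemma hdNK b : cancel (hd V (~~ b)) (hd V b).
Proof. by move=> f; have := @hdK _ V (~~ b) f; rewrite negbK. Qed.

Lemma ip_trC b f g : ip (tr V b f) g = ip f (tr V (~~ b) g).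
Proof. by rewrite -(ip_tr b f) trNK. Qed.

Lemma ip_hdC b f g : ip (hd V b f) g = ip f (hd V (~~ b) g).
Proof. by rewrite -(ip_hd b f) hdNK. Qed.

Fact avg_key : unit. Proof. exact: tt. Qed.
(** Half the sum with the swapped observable, i.e. the orthogonal projection on the
    swap-invariant ones.  It is locked so that rewriting with linearity does not
    look inside it. *)
Definition avg : V -> V := locked_with avg_key (fun f => 2^-1 *: (f + sw V f)).

Lemma avgE f : avg f = 2^-1 *: (f + sw V f).
Proof. by rewrite /avg unlock. Qed.

Lemma sw_avg f : sw V (avg f) = avg f.
Proof. by rewrite !avgE linearZ linearD/= swK addrC. Qed.

Lemma avg_sw f : avg (sw V f) = avg f.
Proof. by rewrite !avgE swK addrC. Qed.

Lemma scale_halfD f : 2^-1 *: (f + f) = f.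
Proof.
rewrite -[f in f + _]scale1r -[f in _ + f]scale1r -scalerDl.
by rewrite scalerA (_ : 2^-1 * (1 + 1) = 1 :> R) ?scale1r//; lra.
Qed.

Lemma avg_fix f : sw V f = f -> avg f = f.
Proof. by move=> ff; rewrite avgE ff scale_halfD. Qed.

Lemma avg_avg f : avg (avg f) = avg f.
Proof. exact/avg_fix/sw_avg. Qed.

Lemma rf_avg f : rf V (avg f) = avg (rf V f).
Proof. by rewrite !avgE linearZ linearD/= rf_sw. Qed.

Lemma ip_avgC f g : ip (avg f) g = ip f (avg g).
Proof. by rewrite !avgE !ipE ip_swC. Qed.

Lemma nrm_avg f : nrm (avg f) + nrm (f - avg f) = nrm f.
Proof.
have : ip (avg f) (avg f) = ip f (avg f) by rewrite ip_avgC avg_avg.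
by rewrite /nrm !ipE (ipC (avg f) f); lra.
Qed.

Lemma nrm_avg_le f : nrm (avg f) <= nrm f.
Proof. by rewrite -(nrm_avg f) lerDl nrm_ge0. Qed.

Lemma nrm_sw f : nrm (sw V f) = nrm f. Proof. exact: ip_sw. Qed.
Lemma nrm_rf f : nrm (rf V f) = nrm f. Proof. exact: ip_rf. Qed.
Lemma nrm_tr b f : nrm (tr V b f) = nrm f. Proof. exact: ip_tr. Qed.
Lemma nrm_hd b f : nrm (hd V b f) = nrm f. Proof. exact: ip_hd. Qed.

Lemma nrm_trB b f : nrm (tr V b f - f) = nrm (tr V true f - f).
Proof.
case: b => //.
rewrite -(nrm_tr true (tr V false f - f)) linearB/=.
by rewrite (trNK true) -nrmN opprB.
Qed.

Lemma ip_second_difference f g :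
  ip (2^-1 *: (tr V true f + tr V false f) - f) g =
  - 2^-1 * ip (tr V true f - f) (tr V true g - g).
Proof.
rewrite !ipE (ip_trC false) /= ip_tr.
by rewrite (ipC f (tr _ _ _)) (ip_trC _ g) /= (ipC g) (ip_trC false) /=; lra.
Qed.

(** The Dirichlet form of the environment dynamics: the distance to the
    swap-invariant observables plus the translation gradient of the projection. *)
Definition dirichlet f : R :=
  nrm (f - avg f) + 2^-1 * nrm (tr V true (avg f) - avg f).

(** The operator U: the four terms of its transition probabilities are exactly the
    projection on swap-invariant observables applied before and after a
    translation. *)
Definition env_op f : V :=
  2^-1 *: (avg (tr V true (avg f)) + avg (tr V false (avg f))) - f.

Lemma dirichlet_ge0 f : 0 <= dirichlet f.
Proof. by rewrite addr_ge0// ?mulr_ge0 ?invr_ge0// nrm_ge0. Qed.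

Lemma ip_env_op f g : ip f (env_op g) =
  - ip (f - avg f) (g - avg g)
  - 2^-1 * ip (tr V true (avg f) - avg f) (tr V true (avg g) - avg g).
Proof.
have := ip_second_difference (avg f) (avg g).
have E : ip (avg f) (avg g) = ip f (avg g) by rewrite ip_avgC avg_avg.
have E' : ip (avg f) g = ip f (avg g) by rewrite ip_avgC.
have A e : ip f (avg (tr V e (avg g))) = ip (tr V (~~ e) (avg f)) (avg g).
  by rewrite -ip_avgC ip_trC negbK.
move=> H; rewrite /env_op [LHS]ipDr [in LHS]ipNr [in LHS]ipZr [in LHS]ipDr !A /=.
move: H; rewrite !ipE E E'; lra.
Qed.

Lemma ip_env_op_dirichlet f : ip f (env_op f) = - dirichlet f.
Proof. by rewrite ip_env_op /dirichlet /nrm opprD. Qed.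

Lemma env_op_sym f g : ip f (env_op g) = ip (env_op f) g.
Proof.
rewrite (ipC (env_op f)) !ip_env_op (ipC (g - _)).
by rewrite (ipC (tr V true (avg g) - _)).
Qed.

Lemma sw_env_op f : sw V (env_op f) = env_op (sw V f).
Proof. by rewrite /env_op linearB linearZ linearD/= !sw_avg avg_sw. Qed.

Lemma rf_env_op f : rf V (env_op f) = env_op (rf V f).
Proof.
rewrite /env_op linearB linearZ linearD/= !rf_avg !rf_tr !rf_avg /=.
by rewrite addrC [in RHS](addrC (avg _)) addrC.
Qed.

(** [true] stands for the second model, where the swap is randomized before and
    after the hand step, and [false] for the first. *)
Definition jump_op (m : bool) f : V :=
  if m then avg (hd V true (avg f)) else hd V true (sw V f).

Definition gen_op (m : bool) (eps : R) f : V := jump_op m f - f + eps *: env_op f.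

Lemma nrm_jump m f : nrm (jump_op m f) <= nrm f.
Proof.
case: m; rewrite /jump_op; last by rewrite nrm_hd nrm_sw.
by rewrite (le_trans (nrm_avg_le _))// nrm_hd nrm_avg_le.
Qed.

Definition energy (eps lam : R) f : R := lam * nrm f + eps * dirichlet f.

(** The jump part is a contraction and therefore only contributes a nonnegative
    term. *)
Lemma energy_le m eps lam f :
  energy eps lam f <= ip f (lam *: f - gen_op m eps f).
Proof.
have := ip_le_nrm f (jump_op m f); have := nrm_jump m f; have := ip_env_op_dirichlet f.
rewrite /gen_op; move: (jump_op m f) (env_op f) => j u; rewrite !ipE /energy => -> //.
by rewrite -/(nrm f); lra.
Qed.

End energy.

(** * The trace inequality and the upper bound *)

Section trace.
Context (R : realFieldType) (V : arrow_space R).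
Implicit Types f g psi : V.

(** Replacing P 0 by P k in the pairing with g costs the pairings of
    P 0 + ... + P (k - 1) with the gradient of g.  Averaging over k < n leaves
    sums of orthogonal vectors, whose norms grow only like the square root of
    their number. *)
Lemma translate_trace (P : nat -> V) (kappa : R) g (n : nat) :
  (forall i, P i.+1 = tr V true (P i)) ->
  (forall i j, ip (P i) (P j) = kappa * (i == j)%:R) ->
  n%:R ^+ 2 * ip (P 0) g ^+ 2 <=
    2 * kappa * (n%:R * nrm g + n%:R ^+ 3 * nrm (tr V true g - g)).
Proof.
move=> PS oP; pose A k : V := \sum_(i < k) P i; pose D := g - tr V false g.
have k0 : 0 <= kappa by have := nrm_ge0 (P 0); rewrite /nrm oP eqxx mulr1.
have nA k : nrm (A k) = k%:R * kappa by exact: nrm_sum_orthogonal.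
have nD : nrm D = nrm (tr V true g - g) by rewrite -nrmN opprB (nrm_trB false).
have step k : ip (P 0) g = ip (P k) g + ip (A k) D.
  elim: k => [|k ->]; first by rewrite /A big_ord0 ip0l addr0.
  rewrite /A big_ord_recr /= -/(A k) PS ip_trC /= /D !ipE; lra.
have E : n%:R * ip (P 0) g = ip (A n) g + \sum_(k < n) ip (A k) D.
  rewrite /A ip_suml -big_split /=.
  under eq_bigr => k _ do rewrite -/(A k) -step.
  by rewrite sumr_const card_ord mulr_natl.
have B1 : ip (A n) g ^+ 2 <= n%:R * kappa * nrm g.
  by rewrite -nA; exact: cauchy_schwarz.
have B2 : (\sum_(k < n) ip (A k) D) ^+ 2 <= n%:R ^+ 3 * kappa * nrm D.
  apply: (le_trans (sqr_sum_le n (fun k => ip (A k) D))).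
  have -> : n%:R ^+ 3 * kappa * nrm D = n%:R * \sum_(k < n) n%:R * kappa * nrm D.
    by rewrite sumr_const card_ord -mulr_natl; ring.
  apply: ler_wpM2l; first exact: ler0n.
  apply: ler_sum => k _; apply: (le_trans (cauchy_schwarz _ _)); rewrite nA.
  by do 2 (apply: ler_wpM2r; rewrite ?nrm_ge0//); rewrite ler_nat ltnW.
rewrite -nD -exprMn E.
have := sqr_ge0 (ip (A n) g - \sum_(k < n) ip (A k) D); move: B1 B2.
set a := ip _ g; set b := \sum_(k < n) _ => B1 B2 B3.
apply: (@le_trans _ _ (2 * (a ^+ 2 + b ^+ 2))); first by nra.
rewrite -mulrA ler_pM2l//.
by apply: (le_trans (lerD B1 B2)); rewrite le_eqVlt; apply/orP; left; apply/eqP; ring.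
Qed.

(** The two terms of [translate_trace] balance for n of order s^-2. *)
Lemma translate_trace_scaled (P : nat -> V) (kappa s : R) g (n : nat) :
  (forall i, P i.+1 = tr V true (P i)) ->
  (forall i j, ip (P i) (P j) = kappa * (i == j)%:R) ->
  1 <= s ^+ 2 * n%:R <= 2 ->
  s ^+ 2 * ip (P 0) g ^+ 2 <=
    2 * kappa * (s ^+ 4 * nrm g + 2 * nrm (tr V true g - g)).
Proof.
move=> PS oP /andP[y1 y2]; have := translate_trace g n PS oP.
have k0 : 0 <= kappa by have := nrm_ge0 (P 0); rewrite /nrm oP eqxx mulr1.
move: (nrm_ge0 g) (nrm_ge0 (tr V true g - g)).
move: (nrm g) (nrm (tr V true g - g)) (ip _ _ ^+ 2) => a b x a0 b0 H.
have y0 : 0 < s ^+ 2 * n%:R by lra.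
have n0 : 0 < n%:R :> R.
  by rewrite lt_neqAle ler0n andbT; apply: contraTneq y0 => <-; rewrite mulr0 ltxx.
have {}H : n%:R * x <= 2 * kappa * (a + n%:R ^+ 2 * b).
  rewrite -(ler_pM2l n0); move: H; congr (_ <= _); ring.
rewrite -(ler_pM2l y0).
apply: (@le_trans _ _ (s ^+ 4 * (n%:R * x))).
  by rewrite le_eqVlt; apply/orP; left; apply/eqP; ring.
apply: (@le_trans _ _ (s ^+ 4 * (2 * kappa * (a + n%:R ^+ 2 * b)))).
  by apply: ler_wpM2l => //; rewrite (exprM s 2 2) sqr_ge0.
rewrite -subr_ge0.
have -> : s ^+ 2 * n%:R * (2 * kappa * (s ^+ 4 * a + 2 * b)) -
    s ^+ 4 * (2 * kappa * (a + n%:R ^+ 2 * b)) =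
  2 * kappa * (s ^+ 4 * a * (s ^+ 2 * n%:R - 1)
    + b * (s ^+ 2 * n%:R) * (2 - s ^+ 2 * n%:R)) by ring.
have s4 : 0 <= s ^+ 4 by rewrite (exprM s 2 2) sqr_ge0.
apply: mulr_ge0; first by lra.
apply: addr_ge0; first by rewrite (mulr_ge0 (mulr_ge0 s4 a0))// subr_ge0.
by rewrite (mulr_ge0 (mulr_ge0 b0 (ltW y0)))// subr_ge0.
Qed.

(** The Dirichlet form of psi only controls the translation gradient of [avg psi].
    This relation records that g can replace psi', which is psi up to a swap, a
    projection or a reflection, at a cost controlled by psi. *)
Definition swap_approx psi psi' g :=
  [/\ sw V g = g, nrm (psi' - g) <= dirichlet psi, nrm g <= nrm psi &
      nrm (tr V true g - g) <= 2 * dirichlet psi].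

Lemma swap_approx_avg psi : swap_approx psi psi (avg psi).
Proof.
split; first exact: sw_avg.
- by rewrite /dirichlet lerDl mulr_ge0 ?invr_ge0// nrm_ge0.
- exact: nrm_avg_le.
- by rewrite /dirichlet; have := nrm_ge0 (psi - avg psi); lra.
Qed.

Lemma swap_approx_sw psi psi' g : swap_approx psi psi' g -> swap_approx psi (sw V psi') g.
Proof. by case=> gg h1 h2 h3; split=> //; rewrite -{1}gg -linearB nrm_sw. Qed.

Lemma swap_approx_self psi psi' g : swap_approx psi psi' g -> swap_approx psi g g.
Proof.
by case=> gg h1 h2 h3; split=> //; rewrite subrr /nrm ip0l dirichlet_ge0.
Qed.

Lemma swap_approx_rf psi psi' g : swap_approx psi psi' g -> swap_approx psi (rf V psi') (rf V g).
Proof.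
case=> gg h1 h2 h3; split.
- by rewrite -rf_sw gg.
- by rewrite -linearB nrm_rf.
- by rewrite nrm_rf.
- by rewrite -(rf_tr false) -linearB nrm_rf nrm_trB.
Qed.

Definition trace_const (eps : R) : R := 2 * (1 + 4 / eps).

Context (eps s : R) (n : nat) (eps_gt0 : 0 < eps).
Hypotheses (s_ge0 : 0 <= s) (s_le1 : s <= 1) (ns : 1 <= s ^+ 2 * n%:R <= 2).
Local Notation K := (trace_const eps).
Local Notation En := (energy eps (s ^+ 4)).

Lemma energy_ge0 psi : 0 <= En psi.
Proof.
by rewrite addr_ge0// mulr_ge0 ?exprn_ge0 ?nrm_ge0 ?dirichlet_ge0// ltW.
Qed.

Lemma dirichlet_le_energy psi : dirichlet psi <= eps^-1 * En psi.
Proof.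
rewrite -(ler_pM2l eps_gt0) mulVKf ?gt_eqF// lerDr.
by rewrite mulr_ge0 ?exprn_ge0 ?nrm_ge0.
Qed.

Lemma nrm_le_energy psi : s ^+ 4 * nrm psi <= En psi.
Proof. by rewrite lerDl mulr_ge0 ?dirichlet_ge0 ?ltW. Qed.

(** Both the norm and the gradient of g are controlled by the energy, with weights
    s^4 and eps: exactly the combination produced by the trace inequality. *)
Lemma trace_energy (P : nat -> V) (kappa : R) psi psi' g :
  (forall i, P i.+1 = tr V true (P i)) ->
  (forall i j, ip (P i) (P j) = kappa * (i == j)%:R) ->
  swap_approx psi psi' g -> s ^+ 2 * ip (P 0) g ^+ 2 <= kappa * K * En psi.
Proof.
move=> PS oP [_ _ gn gt].
have k0 : 0 <= kappa by have := nrm_ge0 (P 0); rewrite /nrm oP eqxx mulr1.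
apply: (le_trans (translate_trace_scaled g PS oP ns)).
have h1 := dirichlet_le_energy psi; have h2 := nrm_le_energy psi.
have h3 : s ^+ 4 * nrm g <= En psi.
  by apply: le_trans h2; apply: ler_wpM2l => //; exact: exprn_ge0.
have -> : kappa * K * En psi = 2 * kappa * (En psi + 2 * (2 * (eps^-1 * En psi))).
  by rewrite /trace_const; field; rewrite gt_eqF.
by apply: ler_wpM2l; lra.
Qed.

Lemma trace_const_gt0 : 0 < K.
Proof. by rewrite mulr_gt0// addr_gt0// divr_gt0. Qed.

(** By the trace inequality for the translates of e_0 the square of Q is at most
    K s^-2 times the energy, and the energy is at most Q. *)
Lemma upper_bound m psi :
  s ^+ 4 *: psi - gen_op m eps psi = avg (ar V (Some 0)) ->
  let Q := ip (avg (ar V (Some 0))) psi in 0 <= Q /\ s ^+ 2 * Q <= K.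
Proof.
move=> psiE Q.
have EQ : En psi <= Q by rewrite /Q ipC -psiE; exact: energy_le.
have Q0 : 0 <= Q := le_trans (energy_ge0 _) EQ.
split => //.
have H := @trace_energy (fun k => ar V (Some k%:Z)) 1 psi psi (avg psi).
have {H} := H _ _ (swap_approx_avg psi).
rewrite -[ip (ar _ _) _]ip_avgC -/Q mul1r => H.
have [->|Qn] := eqVneq Q 0; first by rewrite mulr0 ltW// trace_const_gt0.
have Qp : 0 < Q by rewrite lt_neqAle eq_sym Qn.
rewrite -(ler_pM2r Qp) -mulrA -expr2; apply: le_trans (H _ _) _.
- by move=> i; rewrite tr_ar intS addrC.
- by move=> i j; rewrite ip_ar mul1r.
by rewrite ler_wpM2l// ltW// trace_const_gt0.
Qed.

End trace.

(** * A test vector invariant under the swap *)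

Section test_function.
Context (R : realFieldType) (V : arrow_space R).
Local Notation e x := (ar V (Some x)).
Local Notation q x := (pr V None (Some x)).

Definition interval_sum (j : nat) : V := \sum_(i < j.*2.+1) e (i%:Z - j%:Z).

(** The sum of the intervals centred at 0 of radius less than l, so that its
    coefficient at x is max (l - |x|) 0.  Translating it changes each interval
    only at its two ends. *)
Definition tent (l : nat) : V := \sum_(j < l) interval_sum j.

(** Products of the hand arrow with the m arrows to its right: what the shift by the
    hand arrow creates from an interval of arrows, up to reflection. *)
Definition pair_row (m : nat) : V := \sum_(j < m) q (j%:Z + 1).

Lemma sum_telescope (F : int -> V) (j : nat) :
  \sum_(i < j.*2.+1) (F (i%:Z - j%:Z + 1) - F (i%:Z - j%:Z)) =
  F (j%:Z + 1) - F (- j%:Z).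
Proof.
pose G (i : nat) := F (i%:Z - j%:Z).
transitivity (\sum_(0 <= i < j.*2.+1) (G i.+1 - G i)).
  rewrite big_mkord; apply: eq_bigr => i _; congr (F _ - _); lia.
rewrite telescope_sumr// /G; congr (F _ - F _); lia.
Qed.

Lemma tr_interval_sum j : tr V true (interval_sum j) - interval_sum j = e (j%:Z + 1) - e (- j%:Z).
Proof.
rewrite /interval_sum linear_sum -sumrB -(sum_telescope (fun x => e x)).
by apply: eq_bigr => i _; rewrite tr_ar.
Qed.

Lemma sw_interval_sum j : sw V (interval_sum j) = interval_sum j - e 0 + ar V None.
Proof.
have jlt : (j < j.*2.+1)%N by lia.
rewrite /interval_sum (bigD1 (Ordinal jlt))//= subrr linearD linear_sum/=.
rewrite -[e 0]sw_ar0 swK sw_ar0 (addrC (e 0)) addrK addrC; congr (_ + _).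
apply: eq_bigr => i ij; rewrite sw_ar// subr_eq0; apply: contra_neqN ij => H.
by apply: val_inj; move: H => /eqP[].
Qed.

Lemma ip_interval_sum0 j : ip (e 0) (interval_sum j) = 1.
Proof.
have jlt : (j < j.*2.+1)%N by lia.
rewrite /interval_sum (bigD1 (Ordinal jlt))//= subrr ipDr ip_ar eqxx ip_sumr big1 ?addr0// => i ij.
rewrite ip_ar; case: eqP => // -[] /esym/eqP; rewrite subr_eq0 => /eqP[] H.
by case/eqP: ij; exact/val_inj.
Qed.

Lemma ip_interval_sumN j : ip (ar V None) (interval_sum j) = 0.
Proof. by rewrite /interval_sum ip_sumr big1// => i _; rewrite ip_ar. Qed.

Lemma nrm_interval_sum j : nrm (interval_sum j) = j.*2.+1%:R.
Proof.
rewrite (@nrm_sum_orthogonal _ _ _ (fun i => e (i%:Z - j%:Z)) 1) ?mulr1// => a b.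
by rewrite ip_ar mul1r; congr (nat_of_bool _)%:R; apply/eqP/eqP => [[]|->//]; lia.
Qed.

Lemma sum_odd l : (\sum_(j < l) j.*2.+1 = l ^ 2)%N.
Proof. by elim: l => [|l IHl]; rewrite ?big_ord0// big_ord_recr /= IHl; lia. Qed.

(** Cauchy-Schwarz for a sum of l intervals; the squared norms 2 j + 1 of the
    intervals add up to l^2. *)
Lemma nrm_tent l : nrm (tent l) <= l%:R ^+ 3.
Proof.
apply: (le_trans (nrm_sum_le l interval_sum)).
under eq_bigr do rewrite nrm_interval_sum.
by rewrite -natr_sum sum_odd -natrM -natrX -expnS.
Qed.

Lemma tr_tent l :
  tr V true (tent l) - tent l = \sum_(j < l) (e (j%:Z + 1) - e (- j%:Z)).
Proof.
by rewrite /tent linear_sum -sumrB; apply: eq_bigr => j _; exact: tr_interval_sum.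
Qed.

Lemma nrm_tr_tent l : nrm (tr V true (tent l) - tent l) <= 4 * l%:R.
Proof.
rewrite tr_tent sumrB; apply: (le_trans (nrmD_le _ _)); rewrite nrmN.
rewrite (@nrm_sum_orthogonal _ _ _ (fun i => e (i%:Z + 1)) 1); last first.
  move=> a b; rewrite ip_ar mul1r; congr (nat_of_bool _)%:R.
  by apply/eqP/eqP => [[]|->//]; lia.
rewrite (@nrm_sum_orthogonal _ _ _ (fun i => e (- i%:Z)) 1); first by lra.
move=> a b; rewrite ip_ar mul1r; congr (nat_of_bool _)%:R.
by apply/eqP/eqP => [[]|->//]; lia.
Qed.

(** The tent has coefficient l at 0.  Giving the hand the same coefficient makes the
    vector swap-invariant, so that the swap part of the dynamics does not act on
    it. *)
Definition test_vector (l : nat) : V := l%:R *: ar V None + tent l.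

Lemma sw_test_vector l : sw V (test_vector l) = test_vector l.
Proof.
rewrite /test_vector linearD linearZ/= sw_ar0 /tent linear_sum/=.
under eq_bigr do rewrite sw_interval_sum.
rewrite big_split/= sumrB !sumr_const !card_ord !scaler_nat.
by rewrite addrA [_ + (_ - _)]addrC subrK addrC.
Qed.

Lemma ip_test_vector l : ip (test_vector l) (avg (e 0)) = l%:R.
Proof.
rewrite -ip_avgC avg_fix ?sw_test_vector// /test_vector ipDl ipZl ip_ar mulr0 add0r ipC.
rewrite /tent ip_sumr; under eq_bigr do rewrite ip_interval_sum0.
by rewrite sumr_const card_ord.
Qed.

Lemma nrm_test_vector l : nrm (test_vector l) <= 4 * l%:R ^+ 3.
Proof.
have -> : nrm (test_vector l) = l%:R ^+ 2 + nrm (tent l).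
  rewrite /nrm /test_vector !ipE ip_ar eqxx (ipC (tent l) (ar _ _)).
  have -> : ip (ar V None) (tent l) = 0.
    by rewrite /tent ip_sumr big1// => j _; rewrite ip_interval_sumN.
  by rewrite /=; ring.
have := nrm_tent l; rewrite -!natrX.
have : (l ^ 2)%:R <= (l ^ 3)%:R :> R by rewrite ler_nat; case: l => // l; rewrite leq_pexp2l.
have := ler0n R (l ^ 3); lra.
Qed.

Lemma tr_test_vector l : tr V true (test_vector l) - test_vector l = tr V true (tent l) - tent l.
Proof. by rewrite /test_vector linearD linearZ/= tr_arN opprD addrACA subrr add0r. Qed.

(** By [hd_ar] every arrow of the interval produces the average of its neighbours
    and the product of the hand arrow with a discrete gradient; over the
    interval the gradients telescope to the boundary. *)
Lemma hd_interval_sum j : hd V false (interval_sum j) =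
  2^-1 *: (tr V true (interval_sum j) + tr V false (interval_sum j))
  + 2^-1 *: ((rf V (q (j%:Z + 1)) - q (j%:Z + 1)) + (rf V (q j%:Z) - q j%:Z)).
Proof.
rewrite /interval_sum !linear_sum /=.
under eq_bigr do rewrite hd_ar.
rewrite big_split/= -!scaler_sumr; congr (_ *: _ + _ *: _).
  rewrite -big_split/=; apply: eq_bigr => i _; rewrite !tr_ar addrC //.
rewrite !rf_pr.
transitivity (- (\sum_(i < j.*2.+1) (q (i%:Z - j%:Z + 1) - q (i%:Z - j%:Z))
   + \sum_(i < j.*2.+1) (q (i%:Z - j%:Z + 1 - 1) - q (i%:Z - j%:Z - 1)))).
  by rewrite -big_split/= -sumrN; apply: eq_bigr => i _; rewrite addrK addrA subrK opprB.
have -> := sum_telescope (fun x => q x) j.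
have -> := sum_telescope (fun x => q (x - 1)) j.
rewrite addrK !opprD !opprK addrACA [RHS]addrACA [LHS]addrC.
by congr (_ + _); exact: addrC.
Qed.

Lemma hd_test_vector l : hd V false (test_vector l) - test_vector l =
  (2^-1 *: (tr V true (tent l) + tr V false (tent l)) - tent l)
  + 2^-1 *: ((rf V (pair_row l) - pair_row l)
             + (rf V (pair_row l.-1) - pair_row l.-1)).
Proof.
rewrite /test_vector linearD linearZ/= hd_arN opprD addrACA subrr add0r addrAC.
congr (_ - _); rewrite /tent /pair_row !linear_sum /=.
under eq_bigr do rewrite hd_interval_sum.
rewrite big_split/= -!scaler_sumr; congr (_ *: _ + _ *: _); first by rewrite big_split.
rewrite big_split/= -![in RHS]big_split/=; congr (_ + _).
case: l => [|l]; first by rewrite !big_ord0.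
rewrite big_ord_recl rf_pr oppr0 subrr add0r.
by apply: eq_bigr => j _; rewrite lift0 intS (addrC 1).
Qed.

Lemma nrm_pair_row m : nrm (pair_row m) = m%:R.
Proof.
rewrite (@nrm_sum_orthogonal _ _ _ (fun i => q (i%:Z + 1)) 1) ?mulr1// => a b.
by rewrite ip_prN mul1r; congr (nat_of_bool _)%:R; apply/eqP/eqP => [|->//]; lia.
Qed.

End test_function.

(** * The lower bound *)

Section lower_bound.
Context (R : realFieldType) (V : arrow_space R).
Implicit Types f g psi : V.

(** Swapping turns the products of [pair_row] into products of e_0 with arrows on the
    line.  The row translates as a whole and distinct translates involve
    distinct pairs, hence are orthogonal. *)
Lemma translates_pair_row m (P := fun k : nat => \sum_(j < m)
    pr V (Some k%:Z) (Some (k%:Z + (j%:Z + 1)))) :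
  [/\ forall k, P k.+1 = tr V true (P k),
      forall k k', ip (P k) (P k') = m%:R * (k == k')%:R &
      sw V (pair_row V m) = P 0].
Proof.
rewrite /P; split.
- move=> k; rewrite linear_sum; apply: eq_bigr => j _ /=.
  by rewrite tr_pr; congr (pr V (Some _) (Some _)); lia.
- move=> k k'; rewrite ip_suml.
  have E (i : 'I_m) : ip (pr V (Some k%:Z) (Some (k%:Z + (i%:Z + 1))))
      (\sum_(j < m) pr V (Some k'%:Z) (Some (k'%:Z + (j%:Z + 1)))) = (k == k')%:R.
    rewrite ip_sumr (bigD1 i)//= big1 => [|j ji].
      rewrite addr0 ip_pr; [|lia|lia]; congr (nat_of_bool _)%:R.
      by apply/andP/eqP => [[/eqP[] //]|->]; rewrite !eqxx.
    rewrite ip_pr; [|lia|lia]; case: eqP => //= -[->].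
    by case: eqP => //= h; case/eqP: ji; apply: val_inj => /=; lia.
  under eq_bigr => i _ do rewrite E.
  by rewrite sumr_const card_ord mulr_natl.
- rewrite /pair_row linear_sum; apply: eq_bigr => j _ /=.
  by rewrite sw_pr ?add0r//; lia.
Qed.

Context (eps s : R) (n : nat) (eps_gt0 : 0 < eps).
Hypotheses (s_ge0 : 0 <= s) (s_le1 : s <= 1) (ns : 1 <= s ^+ 2 * n%:R <= 2).
Local Notation K := (trace_const eps).
Local Notation En := (energy eps (s ^+ 4)).

(** The row itself is not transported by translations, since they fix the hand.  Its
    pairing with the swap-invariant approximation of psi' is the pairing of the
    swapped row, to which the trace inequality applies. *)
Lemma ip_pair_row m psi psi' g : swap_approx psi psi' g ->
  s ^+ 2 * ip (pair_row V m) psi' ^+ 2 <= 3 * K * m%:R * En psi.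
Proof.
move=> cl; have [PS oP swP] := translates_pair_row m.
have H := trace_energy eps_gt0 s_ge0 ns PS oP cl.
case: cl => gg h1 _ _.
have E : ip (pair_row V m) psi' =
    ip (pair_row V m) (psi' - g) + ip (sw V (pair_row V m)) g.
  by rewrite ip_swC gg -ipDr subrK.
have B : ip (pair_row V m) (psi' - g) ^+ 2 <= m%:R * dirichlet psi.
  apply: (le_trans (cauchy_schwarz _ _)); rewrite nrm_pair_row.
  by rewrite ler_wpM2l ?ler0n.
have D := dirichlet_le_energy eps_gt0 s_ge0 psi.
have E0 := energy_ge0 eps_gt0 s_ge0 psi.
rewrite E swP; move: H B; set a := ip _ (psi' - g); set b := ip _ g => H B.
have s2 : 0 <= s ^+ 2 <= 1 by rewrite exprn_ge0// exprn_ile1.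
have m0 : 0 <= m%:R :> R by exact: ler0n.
have h : s ^+ 2 * a ^+ 2 <= m%:R * (eps^-1 * En psi).
  apply: (@le_trans _ _ (1 * (m%:R * dirichlet psi))).
    by apply: ler_pM => //; [lra|exact: sqr_ge0|lra].
  by rewrite mul1r ler_wpM2l.
have s2ab : s ^+ 2 * (a + b) ^+ 2 <= 2 * (s ^+ 2 * a ^+ 2 + s ^+ 2 * b ^+ 2).
  have : 0 <= s ^+ 2 * (a - b) ^+ 2 by rewrite mulr_ge0 ?sqr_ge0//; lra.
  by lra.
apply: (le_trans s2ab).
have : 0 <= m%:R * En psi by rewrite mulr_ge0.
have e0 : 0 < eps^-1 by rewrite invr_gt0.
rewrite /trace_const in H *; move: H h; set x := s ^+ 2 * a ^+ 2.
set y := s ^+ 2 * b ^+ 2 => H h mE; have := mulr_ge0 (ltW e0) mE; lra.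
Qed.

(** A second difference pairs with psi as a product of two gradients, one of which is
    controlled by the Dirichlet form. *)
Lemma ip_second_difference_tent l psi psi' g : swap_approx psi psi' g ->
  ip (2^-1 *: (tr V true (tent V l) + tr V false (tent V l)) - tent V l) psi'
    ^+ 2 <= 12 * l%:R * eps^-1 * En psi.
Proof.
case=> gg h1 _ h3; set Th := _ - tent V l.
have nTh : nrm Th <= 4 * l%:R.
  apply: le_trans (nrm_tr_tent V l).
  have -> : Th = 2^-1 *: ((tr V true (tent V l) - tent V l)
                          + (tr V false (tent V l) - tent V l)).
    rewrite /Th [in RHS]addrACA [in RHS]scalerDr; congr (_ + _).
    by rewrite -opprD scalerN scale_halfD.
  have := nrmD_le (tr V true (tent V l) - tent V l) (tr V false (tent V l) - tent V l).
  by rewrite (nrm_trB false) nrmZ; lra.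
have E : ip Th psi' = ip Th (psi' - g) + ip Th g by rewrite -ipDr subrK.
have E2 : ip Th g = - 2^-1 * ip (tr V true (tent V l) - tent V l) (tr V true g - g).
  exact: ip_second_difference.
have B1 : ip Th (psi' - g) ^+ 2 <= 4 * l%:R * dirichlet psi.
  by apply: (le_trans (cauchy_schwarz _ _)); apply: ler_pM; rewrite ?nrm_ge0.
have B2 : ip (tr V true (tent V l) - tent V l) (tr V true g - g) ^+ 2 <=
    4 * l%:R * (2 * dirichlet psi).
  apply: (le_trans (cauchy_schwarz _ _)); apply: ler_pM; rewrite ?nrm_ge0//.
  exact: nrm_tr_tent.
rewrite E E2; move: B1 B2; set a := ip Th _; set b := ip _ _ => B1 B2.
have D := dirichlet_le_energy eps_gt0 s_ge0 psi.
have l0 : 0 <= l%:R :> R by exact: ler0n.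
apply: (@le_trans _ _ (12 * l%:R * dirichlet psi)).
  by have := sqr_ge0 (a + 2^-1 * b); lra.
by rewrite -[leRHS]mulrA ler_wpM2l// mulr_ge0.
Qed.

(** Against swap-invariant vectors the jump parts of both models act as the bare hand
    step, on an observable that differs from psi by a projection or a swap. *)
Lemma jump_swap_approx m psi : exists psi', [/\ swap_approx psi psi' (avg psi),
  forall f, sw V f = f -> ip f psi = ip f psi' &
  forall f, sw V f = f -> ip f (jump_op m psi) = ip f (hd V true psi')].
Proof.
case: m; [exists (avg psi) | exists (sw V psi)]; split => //.
- exact/swap_approx_self/swap_approx_avg.
- by move=> f ff; rewrite -ip_avgC avg_fix.
- by move=> f ff; rewrite /jump_op -ip_avgC avg_fix.
- exact/swap_approx_sw/swap_approx_avg.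
- by move=> f ff; rewrite -ip_swC ff.
Qed.

(** The adjoint of the hand step shifts the test vector backwards; by
    [hd_test_vector] this produces a second difference and four rows of
    products, each estimated by the energy. *)
Lemma ip_test_vector_jump m l psi :
  s ^+ 2 * ip (test_vector V l) (jump_op m psi - psi) ^+ 2 <= 36 * K * l%:R * En psi.
Proof.
have [psi' [cl fE jE]] := jump_swap_approx m psi.
have -> : ip (test_vector V l) (jump_op m psi - psi) =
    ip (hd V false (test_vector V l) - test_vector V l) psi'.
  by rewrite ipDr ipNr jE ?sw_test_vector// fE ?sw_test_vector// [RHS]ipDl ipNl ip_hdC.
have := ip_second_difference_tent l cl.
have := ip_pair_row l cl; have := ip_pair_row l.-1 cl.
have := ip_pair_row l (swap_approx_rf cl); have := ip_pair_row l.-1 (swap_approx_rf cl).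
rewrite -!ip_rfC hd_test_vector; move: (2^-1 *: _ - tent V l) => Th.
rewrite !ipE; set a1 := ip _ psi'; set a2 := ip _ psi'; set a3 := ip _ psi'.
set a4 := ip _ psi'; set b := ip _ psi' => H1 H2 H3 H4 H5.
have s2 : 0 <= s ^+ 2 <= 1 by rewrite exprn_ge0// exprn_ile1.
have E0 := energy_ge0 eps_gt0 s_ge0 psi.
have lE : l.-1%:R * En psi <= l%:R * En psi by rewrite ler_wpM2r// ler_nat leq_pred.
have K0 := trace_const_gt0 eps_gt0.
have {}H1 : s ^+ 2 * a1 ^+ 2 <= 3 * K * l%:R * En psi.
  apply: (le_trans H1); rewrite -[leLHS]mulrA -[leRHS]mulrA.
  by apply: ler_wpM2l => //; lra.
have {}H3 : s ^+ 2 * a3 ^+ 2 <= 3 * K * l%:R * En psi.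
  apply: (le_trans H3); rewrite -[leLHS]mulrA -[leRHS]mulrA.
  by apply: ler_wpM2l => //; lra.
have {}H5 : s ^+ 2 * b ^+ 2 <= 6 * K * l%:R * En psi.
  apply: (@le_trans _ _ (1 * (12 * l%:R * eps^-1 * En psi))).
    by apply: ler_pM => //; [lra|exact: sqr_ge0|lra].
  have -> : 1 * (12 * l%:R * eps^-1 * En psi) = 12 / eps * (l%:R * En psi) by ring.
  rewrite -[leRHS]mulrA ler_wpM2r ?mulr_ge0// /trace_const.
  by have := divr_gt0 ltr01 eps_gt0; lra.
pose X := b + 2^-1 * (a2 - a4 + (a1 - a3)).
have h : s ^+ 2 * X ^+ 2 <= 2 * (s ^+ 2 * b ^+ 2) + 2 * (s ^+ 2 * a1 ^+ 2
    + s ^+ 2 * a2 ^+ 2 + s ^+ 2 * a3 ^+ 2 + s ^+ 2 * a4 ^+ 2).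
  have -> : 2 * (s ^+ 2 * b ^+ 2) + 2 * (s ^+ 2 * a1 ^+ 2
    + s ^+ 2 * a2 ^+ 2 + s ^+ 2 * a3 ^+ 2 + s ^+ 2 * a4 ^+ 2) =
    s ^+ 2 * (2 * b ^+ 2 + 2 * (a1 ^+ 2 + a2 ^+ 2 + a3 ^+ 2 + a4 ^+ 2)) by ring.
  rewrite ler_wpM2l//; first by case/andP: s2.
  have := sqr_ge0 (b - 2^-1 * (a2 - a4 + (a1 - a3))).
  have := sqr_ge0 (a1 + a3); have := sqr_ge0 (a2 + a4).
  have := sqr_ge0 (a1 - a3 - (a2 - a4)); rewrite /X; nra.
rewrite -/X; apply: (le_trans h).
by have := mulr_ge0 (mulr_ge0 (ltW K0) (ler0n R l)) E0; lra.
Qed.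

Lemma ip_test_vector_env_op l psi :
  (eps * ip (test_vector V l) (env_op psi)) ^+ 2 <= 2 * eps * l%:R * En psi.
Proof.
rewrite ip_env_op avg_fix ?sw_test_vector// subrr ip0l oppr0 sub0r tr_test_vector.
set a := ip _ _.
have B : a ^+ 2 <= 4 * l%:R * (2 * dirichlet psi).
  apply: (le_trans (cauchy_schwarz _ _)); apply: ler_pM; rewrite ?nrm_ge0//.
    exact: nrm_tr_tent.
  by case: (swap_approx_avg psi).
have D : eps * dirichlet psi <= En psi.
  by rewrite lerDr mulr_ge0 ?exprn_ge0 ?nrm_ge0.
have e2 : 0 <= eps ^+ 2 := sqr_ge0 _.
have l0 : 0 <= 2 * eps * l%:R by rewrite !mulr_ge0// ltW.
have -> : (eps * - (2^-1 * a)) ^+ 2 = eps ^+ 2 * (4^-1 * a ^+ 2) by field.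
apply: (@le_trans _ _ (2 * eps * l%:R * (eps * dirichlet psi))).
  rewrite (_ : 2 * eps * l%:R * _ = eps ^+ 2 * (2 * l%:R * dirichlet psi)); last by ring.
  by rewrite ler_wpM2l//; lra.
by rewrite ler_wpM2l.
Qed.

(** Pairing the resolvent equation with the test vector writes l as the sum of a
    resolvent term, a jump term and an environment term.  For l of order s^-3
    each of them has square at most of order s^-2 l times the energy. *)
Lemma lower_bound_energy m psi l : 1 <= s ^+ 3 * l%:R <= 2 ->
  s ^+ 4 *: psi - gen_op m eps psi = avg (ar V (Some 0)) ->
  s ^+ 2 * l%:R <= 3 * (16 + 36 * K + 2 * eps) * En psi.
Proof.
move=> /andP[l1 l2] psiE.
have K0 := trace_const_gt0 eps_gt0.
have E0 := energy_ge0 eps_gt0 s_ge0 psi.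
have s2 : 0 <= s ^+ 2 <= 1 by rewrite exprn_ge0// exprn_ile1.
have l0 : 0 < l%:R :> R.
  rewrite lt_neqAle ler0n andbT; apply: contraTneq l1 => <-.
  by rewrite mulr0 -ltNge ltr01.
have E : l%:R = s ^+ 4 * ip (test_vector V l) psi - ip (test_vector V l) (jump_op m psi - psi)
    - eps * ip (test_vector V l) (env_op psi).
  by rewrite -(ip_test_vector V l) -psiE /gen_op; move: (jump_op m psi - psi) (env_op psi) (test_vector V l) => j u f; rewrite !ipE; ring.
have H1 : (s ^+ 4 * ip (test_vector V l) psi) ^+ 2 <= s ^+ 4 * (4 * l%:R ^+ 3) * En psi.
  rewrite exprMn.
  apply: (@le_trans _ _ ((s ^+ 4) ^+ 2 * (4 * l%:R ^+ 3 * nrm psi))).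
    rewrite ler_wpM2l ?sqr_ge0//; apply: (le_trans (cauchy_schwarz _ _)).
    by rewrite ler_wpM2r ?nrm_ge0// nrm_test_vector.
  have -> : (s ^+ 4) ^+ 2 * (4 * l%:R ^+ 3 * nrm psi) =
    s ^+ 4 * (4 * l%:R ^+ 3) * (s ^+ 4 * nrm psi) by ring.
  apply: ler_wpM2l; last exact: nrm_le_energy.
  by rewrite !mulr_ge0 ?exprn_ge0// ltW.
have H2 := ip_test_vector_jump m l psi; have H3 := ip_test_vector_env_op l psi.
move: E H1 H2 H3; set a := s ^+ 4 * _; set b := ip _ _; set c := eps * _.
move=> E H1 H2 H3.
have H1' : s ^+ 2 * a ^+ 2 <= 16 * l%:R * En psi.
  apply: (@le_trans _ _ (s ^+ 2 * (s ^+ 4 * (4 * l%:R ^+ 3) * En psi))).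
    by rewrite ler_wpM2l//; case/andP: s2.
  have -> : s ^+ 2 * (s ^+ 4 * (4 * l%:R ^+ 3) * En psi) =
    (4 * (s ^+ 3 * l%:R) ^+ 2) * (l%:R * En psi) by ring.
  by rewrite -[leRHS]mulrA ler_wpM2r ?mulr_ge0 ?(ltW l0)//; nra.
have H3' : s ^+ 2 * c ^+ 2 <= 2 * eps * l%:R * En psi.
  apply: le_trans H3; rewrite -[leRHS]mul1r ler_wpM2r ?sqr_ge0//.
  by case/andP: s2.
have H : s ^+ 2 * l%:R ^+ 2 <= 3 * (s ^+ 2 * a ^+ 2 + s ^+ 2 * b ^+ 2 + s ^+ 2 * c ^+ 2).
  have -> : 3 * (s ^+ 2 * a ^+ 2 + s ^+ 2 * b ^+ 2 + s ^+ 2 * c ^+ 2) =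
    s ^+ 2 * (3 * (a ^+ 2 + b ^+ 2 + c ^+ 2)) by ring.
  rewrite ler_wpM2l//; first by case/andP: s2.
  rewrite E; have := sqr_ge0 (a + b); have := sqr_ge0 (a + c).
  by have := sqr_ge0 (b - c); lra.
rewrite -(ler_pM2r l0) (_ : _ * l%:R * l%:R = s ^+ 2 * l%:R ^+ 2); last by ring.
by apply: (le_trans H); lra.
Qed.

Lemma lower_bound m psi l : 0 < s -> 1 <= s ^+ 3 * l%:R <= 2 ->
  s ^+ 4 *: psi - gen_op m eps psi = avg (ar V (Some 0)) ->
  1 <= 3 * (16 + 36 * K + 2 * eps) * (s * ip (avg (ar V (Some 0))) psi).
Proof.
move=> s0 l12 psiE; have H := lower_bound_energy l12 psiE.
case/andP: l12 => l1 _; apply: (le_trans l1).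
rewrite exprS -[leLHS]mulrA [leRHS]mulrCA ler_pM2l//; apply: (le_trans H).
have K0 := trace_const_gt0 eps_gt0.
apply: ler_wpM2l; first by rewrite mulr_ge0// !addr_ge0// mulr_ge0// ltW.
by rewrite -psiE ipC; exact: energy_le.
Qed.

End lower_bound.

(** * Drift along the hand arrow *)

Section hand_bound.
Context (R : realFieldType) (V : arrow_space R).
Implicit Types f g psi : V.
Local Notation e0 := (ar V (Some 0)).
Local Notation eh := (ar V None).

(** In the first model time reversal amounts to exchanging the two half-lines and
    swapping: the jump part is a shift after a swap, whose adjoint is conjugate to
    it by reflection and swap, and the environment part commutes with both. *)
Lemma reversal_symmetry eps lam f g :
  ip f (sw V (rf V (lam *: g - gen_op false eps g))) =
  ip g (sw V (rf V (lam *: f - gen_op false eps f))).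
Proof.
have J h k : ip h (sw V (rf V k)) = ip k (sw V (rf V h)).
  by rewrite -ip_swC -ip_rfC rf_sw ipC.
have W h k : ip h (sw V (rf V (jump_op false k))) = ip k (sw V (rf V (jump_op false h))).
  rewrite /jump_op -ip_swC -ip_rfC -(ip_hdC false) -ip_swC ipC.
  by rewrite -(rf_hd true).
have U h k : ip h (sw V (rf V (env_op k))) = ip k (sw V (rf V (env_op h))).
  by rewrite J -!env_op_sym -sw_env_op -rf_env_op.
have E h k : ip h (sw V (rf V (lam *: k - gen_op false eps k))) =
    lam * ip h (sw V (rf V k)) - ip h (sw V (rf V (jump_op false k)))
    + ip h (sw V (rf V k)) - eps * ip h (sw V (rf V (env_op k))).
  have D x y : ip h (sw V (rf V (x + y))) = ip h (sw V (rf V x)) + ip h (sw V (rf V y)).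
    by rewrite !linearD ipDr.
  have Z a x : ip h (sw V (rf V (a *: x))) = a * ip h (sw V (rf V x)) by rewrite !linearZ/= ipZr.
  rewrite /gen_op; move: (jump_op false k) (env_op k) => j u.
  rewrite -[- (j - k + _)]scaleN1r -[- k]scaleN1r !(D, Z); ring.
by rewrite !E (J f g) (W f g) (U f g).
Qed.

(** With d = e_* - phi one has e_0 = phi - d and, by [reversal_symmetry],
    <phi, psi2> = - <d, psi1>.  Hence <e_0, psi1 + psi2> = Q - q - 2 <d, psi1>
    with q = <d, psi2>.  Since d is antisymmetric under the swap, its pairing
    with any observable only sees the distance to the swap-invariant ones, which
    the energy controls with weight eps: this bounds q by 1 / (2 eps) and the last
    term by a multiple of the geometric mean of Q and 1 / eps. *)
Lemma hand_bound (eps lam : R) psi1 psi2 : 0 < eps -> 0 <= lam ->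
  lam *: psi1 - gen_op false eps psi1 = avg e0 ->
  lam *: psi2 - gen_op false eps psi2 = eh - avg e0 ->
  ip (avg e0) psi1 / 2 - 3 / (2 * eps) <= ip e0 (psi1 + psi2)
    <= 3 * ip (avg e0) psi1 / 2 + 1 / eps.
Proof.
move=> eps0 lam0 E1 E2; set Q := ip (avg e0) psi1.
have dE : e0 = avg e0 - (eh - avg e0).
  rewrite opprB addrA -[e0 in LHS]addr0 -(subrr eh) addrA [e0 + _]addrC; congr (_ - _).
  by rewrite avgE -scalerDr -(sw_ar0 V) swK addrC scale_halfD.
have swd : sw V (eh - avg e0) = - (eh - avg e0).
  by rewrite linearB/= sw_avg sw_ar0 {1}dE [avg e0 - _]addrC addrK.
have rfd : rf V (eh - avg e0) = eh - avg e0.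
  by rewrite linearB/= rf_avg rf_arN rf_ar oppr0.
have nd : nrm (eh - avg e0) = 2^-1.
  rewrite avgE -(sw_ar0 V) swK sw_ar0 /nrm !ipE !ip_ar /=; lra.
move: (eh - avg e0) dE swd rfd nd E2 => d dE swd rfd nd E2.
have ad : avg d = 0 by rewrite avgE swd subrr scaler0.
have small psi a : energy eps lam psi <= a -> (ip d psi) ^+ 2 <= a / (2 * eps).
  move=> H; have : ip d psi = ip d (psi - avg psi).
    by rewrite ipDr ipNr -ip_avgC ad ip0l subr0.
  move=> ->; apply: (le_trans (cauchy_schwarz _ _)); rewrite nd.
  have -> : a / (2 * eps) = 2^-1 * (a / eps) by rewrite invfM mulrCA.
  rewrite ler_pM2l ?invr_gt0// ler_pdivlMr// mulrC.
  apply: le_trans H; rewrite /energy /dirichlet.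
  have := mulr_ge0 lam0 (nrm_ge0 psi).
  by have := mulr_ge0 (ltW eps0) (nrm_ge0 (tr V true (avg psi) - avg psi)); lra.
have h1 : energy eps lam psi1 <= Q by rewrite /Q -E1 ipC; exact: energy_le.
have h2 : energy eps lam psi2 <= ip d psi2 by rewrite -E2 ipC; exact: energy_le.
have Q0 : 0 <= Q.
  by apply: le_trans h1; rewrite addr_ge0// mulr_ge0 ?nrm_ge0 ?dirichlet_ge0// ltW.
have q0 : 0 <= ip d psi2.
  by apply: le_trans h2; rewrite addr_ge0// mulr_ge0 ?nrm_ge0 ?dirichlet_ge0// ltW.
(* The vectors phi = avg e0 and d are fixed by the reflection, and under the swap
   phi is fixed while d changes sign. *)
have S : ip d psi1 = - ip (avg e0) psi2.
  have := reversal_symmetry eps lam psi1 psi2.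
  rewrite E1 E2 rfd swd rf_avg rf_ar oppr0 sw_avg ipNr (ipC psi1) (ipC psi2) => <-.
  by rewrite opprK.
have i0 : 0 < eps^-1 by rewrite invr_gt0.
have B1 := small _ _ h1; have B2 := small _ _ h2.
have q1 : ip d psi2 <= (2 * eps)^-1.
  have [->|qn] := eqVneq (ip d psi2) 0; first by rewrite invr_ge0 mulr_ge0// ltW.
  have qp : 0 < ip d psi2 by rewrite lt_neqAle eq_sym qn.
  by rewrite -(ler_pM2l qp) -expr2.
have y2 : `|2 * ip d psi1| <= Q / 2 + eps^-1.
  rewrite -(@ler_pXn2r _ 2) ?nnegrE//; last by rewrite addr_ge0 ?divr_ge0// ltW.
  rewrite real_normK ?num_real//.
  have := sqr_ge0 (Q / 2 - eps^-1); move: B1; rewrite invfM.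
  move: (ip d psi1) (eps^-1) => x i; lra.
have -> : ip e0 (psi1 + psi2) = Q - ip d psi2 - 2 * ip d psi1.
  by rewrite dE !ipE /Q S; ring.
move: y2 q1; rewrite ler_norml invfM div1r => /andP[y1 y2] q1.
by apply/andP; split; lra.
Qed.

End hand_bound.

(** * Bounded measurable functions and the i.i.d. uniform law *)

Section bounded_measurable.
Context {R : realType} {d : measure_display} {T : measurableType d}.
Implicit Types f g : T -> R.

Definition bounded_measurable f :=
  measurable_fun setT f /\ exists M, forall x, `|f x| <= M.

Definition bdm : {pred T -> R} := fun f => `[< bounded_measurable f >].

Lemma bdmP f : f \in bdm <-> bounded_measurable f.
Proof. by split; [move/asboolP | move=> ?; exact/asboolP]. Qed.

Lemma bounded_measurable_cst a : bounded_measurable (fun=> a).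
Proof. by split => //; exists `|a|. Qed.

Lemma bounded_measurableD f g : bounded_measurable f -> bounded_measurable g ->
  bounded_measurable (fun x => f x + g x).
Proof.
move=> [mf [M fM]] [mg [N gN]]; split; first exact: measurable_funD.
by exists (M + N) => x; rewrite (le_trans (ler_normD _ _))// lerD.
Qed.

Lemma bounded_measurableM f g : bounded_measurable f -> bounded_measurable g ->
  bounded_measurable (fun x => f x * g x).
Proof.
move=> [mf [M fM]] [mg [N gN]]; split; first exact: measurable_funM.
by exists (M * N) => x; rewrite normrM ler_pM.
Qed.

Lemma bounded_measurableZ a f : bounded_measurable f ->
  bounded_measurable (fun x => a * f x).
Proof. by move=> bf; apply: bounded_measurableM => //; exact: bounded_measurable_cst. Qed.

Lemma bounded_measurableB f g : bounded_measurable f -> bounded_measurable g ->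
  bounded_measurable (fun x => f x - g x).
Proof.
move=> bf /(bounded_measurableZ (- 1)) bg.
by under eq_fun => x do rewrite -mulN1r; exact: bounded_measurableD.
Qed.

Lemma bdm_submod_closed : submod_closed bdm.
Proof.
split=> [|a f g /bdmP bf /bdmP bg]; apply/bdmP.
  exact: (bounded_measurable_cst 0).
exact: (bounded_measurableD (bounded_measurableZ a bf) bg).
Qed.

HB.instance Definition _ := GRing.isSubmodClosed.Build _ _ bdm bdm_submod_closed.

(** The bounded measurable functions as a vector space, so that compositions can be
    linear operators. *)
Record bdm_fun := BdmFun { bdm_val :> T -> R; _ : bdm_val \in bdm }.

HB.instance Definition _ := [isSub for bdm_val].
HB.instance Definition _ := [Choice of bdm_fun by <:].
HB.instance Definition _ := [SubChoice_isSubLmodule of bdm_fun by <:].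

Lemma bdm_funP (F : bdm_fun) : bounded_measurable F.
Proof. by apply/bdmP; exact: valP. Qed.

Definition bdm_of f (bf : bounded_measurable f) : bdm_fun := BdmFun ((bdmP f).2 bf).

Lemma bdm_ext (F G : bdm_fun) : F =1 G -> F = G.
Proof. by move=> FG; apply/val_inj/funext. Qed.

End bounded_measurable.
Arguments bdm_fun R {d} T.

Section expectation.
Context {R : realType} {d : measure_display} {T : measurableType d}.
Variable mu : probability T R.
Implicit Types f g : T -> R.

Definition expect f : R := \int[mu]_x f x.

Lemma bounded_measurable_bounded f : bounded_measurable f ->
  [bounded f x | x in setT].
Proof.
by case=> _ [M fM]; exists M; split; [exact: num_real|move=> y My x _; exact: le_trans (fM x) (ltW My)].
Qed.

Lemma bounded_measurable_integrable f : bounded_measurable f ->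
  mu.-integrable setT (EFin \o f).
Proof.
move=> bf; apply: measurable_bounded_integrable => //; last exact: bounded_measurable_bounded.
  by rewrite (le_lt_trans (probability_le1 mu measurableT))// ltry.
by case: bf.
Qed.

Lemma expectD f g : bounded_measurable f -> bounded_measurable g ->
  expect (fun x => f x + g x) = expect f + expect g.
Proof. by move=> bf bg; apply: RintegralD => //; exact: bounded_measurable_integrable. Qed.

Lemma expectZ a f : bounded_measurable f ->
  expect (fun x => a * f x) = a * expect f.
Proof. by move=> bf; apply: RintegralZl => //; exact: bounded_measurable_integrable. Qed.

Lemma expect_cst a : expect (fun=> a) = a.
Proof.
rewrite /expect Rintegral_cst// (_ : fine _ = 1) ?mulr1//.
by rewrite -[RHS]/(fine 1%E); congr fine; exact: probability_setT.
Qed.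

Lemma expect_ge0 f : (forall x, 0 <= f x) -> 0 <= expect f.
Proof. by move=> f0; apply: Rintegral_ge0. Qed.

Lemma expect_le f g : bounded_measurable f -> bounded_measurable g ->
  (forall x, f x <= g x) -> expect f <= expect g.
Proof. by move=> bf bg fg; apply: le_Rintegral => //; exact: bounded_measurable_integrable. Qed.

Lemma expect_norm_le f M : bounded_measurable f ->
  (forall x, `|f x| <= M) -> `|expect f| <= M.
Proof.
move=> bf fM; rewrite ler_norml; apply/andP; split.
- rewrite -(expect_cst (- M)); apply: expect_le => // [|x].
    exact: bounded_measurable_cst.
  by have := fM x; rewrite ler_norml => /andP[].
- rewrite -(expect_cst M); apply: expect_le => // [|x].
    exact: bounded_measurable_cst.
  by have := fM x; rewrite ler_norml => /andP[].
Qed.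

End expectation.

Section measurable_config.
Context {d : measure_display} {T : measurableType d}.

Lemma measurable_coord x b : measurable [set w : config | w x = b].
Proof. by apply: sub_sigma_algebra; exists x, b. Qed.

Lemma measurable_to_config (phi : T -> config) :
  (forall x, measurable_fun setT (fun t => phi t x)) -> measurable_fun setT phi.
Proof.
move=> H; apply: (@measurability _ _ T config setT phi cylinders erefl).
move=> _ [_ [x [b ->]] <-]; rewrite setTI.
have := H x measurableT [set b] I; rewrite setTI; congr measurable.
Qed.

Lemma measurable_eval x : measurable_fun setT (fun w : config => w x).
Proof.
move=> _ B _; rewrite setTI.
have [Bt|Bt] := pselect (B true); have [Bf|Bf] := pselect (B false).
- by rewrite [X in measurable X](_ : _ = setT)//; apply/seteqP; split=> // w _ /=; case: (w x).
- rewrite [X in measurable X](_ : _ = [set w : config | w x = true]); first exact: measurable_coord.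
  by apply/seteqP; split=> w /=; case: (w x).
- rewrite [X in measurable X](_ : _ = [set w : config | w x = false]); first exact: measurable_coord.
  by apply/seteqP; split=> w /=; case: (w x).
- by rewrite [X in measurable X](_ : _ = set0)//; apply/seteqP; split=> // w /=; case: (w x).
Qed.

End measurable_config.

Section relabelling.
Context {R : realType}.

(** Every map of the model that does not read the configuration permutes the sites,
    and flips some arrows in the case of [flip]; one invariance lemma covers them
    all. *)
Definition relabel (p : option int -> option int) (c : option int -> bool)
  (w : config) : config := fun x => c x (+) w (p x).

Lemma measurable_relabel p c : measurable_fun setT (relabel p c).
Proof.
apply: measurable_to_config => x.
by apply: (measurableT_comp (f := addb (c x))) => //; exact: measurable_eval.
Qed.

(** The cylinders over finitely many sites are stable under intersection and
    generate the sigma-algebra. *)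
Lemma iid_uniform_unique (mu nu : probability config R) :
  iid_uniform mu id -> iid_uniform nu id ->
  forall A, measurable A -> mu A = nu A.
Proof.
move=> hmu hnu.
pose G : set (set config) := [set A | A = set0 \/ exists s b, uniq s /\
   A = [set w | forall x, x \in s -> w x = b x]].
have Gm : G `<=` measurable.
  move=> _ [->//|[s [b [us ->]]]]; elim: s us => [|y s IHs] us.
    by rewrite [X in measurable X](_ : _ = setT)//; apply/seteqP; split.
  rewrite [X in measurable X](_ : _ = [set w : config | w y = b y] `&`
     [set w | forall x, x \in s -> w x = b x]).
    apply: measurableI; first exact: measurable_coord.
    by apply: IHs; case/andP: us.
  apply/seteqP; split=> w /= h.
    by split=> [|x xs]; apply: h; rewrite inE ?eqxx// xs orbT.
  by move=> x; rewrite inE => /orP[/eqP->|]; [case: h|case: h => _; exact].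
have GT : G setT.
  by right; exists [::], (fun=> true); split=> //; apply/seteqP; split.
move=> A mA.
apply: (@g_sigma_algebra_measure_unique _ R config G Gm (fun=> setT)) => //.
- by apply/seteqP; split=> // w _; exists 0%N.
- move=> B C [->|[s [b [us ->]]]]; first by rewrite set0I; left.
  move=> [->|[s' [b' [us' ->]]]]; first by rewrite setI0; left.
  have [H|H] := pselect (exists x, [/\ x \in s, x \in s' & b x <> b' x]).
    left; apply/seteqP; split=> // w [] /= h h'.
    by case: H => x [xs xs' []]; rewrite -h// -h'.
  right; exists (undup (s ++ s')), (fun x => if x \in s then b x else b' x).
  split; first exact: undup_uniq.
  apply/seteqP; split=> w /=.
    move=> [h h'] x; rewrite mem_undup mem_cat; case: ifPn => [xs _|_ /=]; [exact: h|exact: h'].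
  move=> h; split=> x xs; have := h x; rewrite mem_undup mem_cat xs ?orbT => /(_ isT) ->//.
  by case: ifPn => // xs'; apply: contrapT => bb; apply: H; exists x.
- move=> _ [->|[s [b [us ->]]]]; first by rewrite !measure0.
  exact: etrans (hmu s b us) (esym (hnu s b us)).
- by move=> k; rewrite (le_lt_trans (probability_le1 mu measurableT))// ltry.
apply: (@sub_sigma_algebra2 _ setT G cylinders _ A mA).
move=> _ [x [b ->]]; right; exists [:: x], (fun=> b); split=> //.
apply/seteqP; split=> w /= h; first by move=> y; rewrite inE => /eqP->.
by apply: h; rewrite inE.
Qed.

Lemma iid_relabel (mu : probability config R) p p' c :
  cancel p p' -> cancel p' p ->
  iid_uniform mu id -> iid_uniform mu (relabel p c).
Proof.
move=> pK p'K hmu s b us.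
rewrite -(size_map p) -(hmu (map p s) (fun y => c (p' y) (+) b (p' y))); last first.
  by rewrite map_inj_uniq//; exact: can_inj pK.
congr (mu _); apply/seteqP; split=> w /= h.
  by move=> _ /mapP[x xs ->]; rewrite pK -(h x xs) /relabel addKb.
by move=> x xs; rewrite /relabel (h (p x)) ?map_f// pK addKb.
Qed.

Lemma expect_preserving (mu : probability config R) (phi : config -> config) f :
  measurable_fun setT phi -> iid_uniform mu id -> iid_uniform mu phi ->
  bounded_measurable f -> expect mu (fun w => f (phi w)) = expect mu f.
Proof.
move=> mphi hmu hphi bf.
pose Phi : {mfun config >-> config} := HB.pack phi (isMeasurableFun.Build _ _ _ _ _ mphi).
have hnu : iid_uniform (distribution mu Phi) id by [].
rewrite /expect /Rintegral; congr fine.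
transitivity (\int[distribution mu Phi]_w (f w)%:E)%E.
  rewrite integral_distribution//; first by apply/measurable_EFinP; case: bf.
  apply: bounded_measurable_integrable; case: bf => mf [M fM]; split; last by exists M.
  exact: measurableT_comp.
apply: eq_measure_integral => A mA _; exact: iid_uniform_unique.
Qed.

Lemma expect_relabel (mu : probability config R) p p' c f :
  cancel p p' -> cancel p' p -> iid_uniform mu id ->
  bounded_measurable f -> expect mu (fun w => f (relabel p c w)) = expect mu f.
Proof.
move=> pK p'K hmu; apply: expect_preserving => //; first exact: measurable_relabel.
exact: iid_relabel p'K hmu.
Qed.

End relabelling.

(** * Maps preserving the i.i.d. uniform law *)

Section config_maps.
Context {R : realType}.

Definition sgn (b : bool) : R := if b then 1 else -1.

Lemma sgnE b : sgn b = (arrow b)%:~R.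
Proof. by case: b. Qed.

Lemma sgn2 b : sgn b * sgn b = 1.
Proof. by case: b; rewrite /sgn ?mulr1// mulrNN mulr1. Qed.

(** [hand_shift true] is the hand step and [hand_shift false] its inverse. *)
Definition hand_shift (b : bool) (w : config) : config :=
  Defs.shift (arrow (b == w None)) w.

Definition reflect (w : config) : config :=
  fun x => if x is Some y then w (Some (- y)) else w None.

Definition flip (x : option int) : config -> config := relabel id (fun y => y == x).

Definition swap_site (x : option int) : option int :=
  if x == Some 0 then None else if x == None then Some 0 else x.

Lemma swap_siteK : involutive swap_site.
Proof.
move=> [x|] //=; rewrite /swap_site/=; case: (eqVneq (Some x) (Some 0)) => [->//|x0].
by rewrite (negbTE x0).
Qed.

Lemma swap_relabel : swap = relabel swap_site (fun=> false).
Proof.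
apply/funext => w; apply/funext => x; rewrite /relabel /swap /swap_site/=.
by case: ifP => // _; case: ifP.
Qed.

Lemma step_relabel e : step e = relabel (omap (fun y => y + arrow e)) (fun=> false).
Proof. by apply/funext => w; apply/funext => -[x|]. Qed.

Lemma reflect_relabel : reflect = relabel (omap -%R) (fun=> false).
Proof. by apply/funext => w; apply/funext => -[x|]. Qed.

Lemma arrow_negb e : arrow (~~ e) = - arrow e.
Proof. by case: e. Qed.

Lemma swapK : involutive swap.
Proof.
move=> w; rewrite swap_relabel; apply/funext => x.
by rewrite /relabel/= swap_siteK.
Qed.

Lemma stepK e : cancel (step (~~ e)) (step e).
Proof.
by move=> w; apply/funext => -[x|] //=; rewrite arrow_negb addrK.
Qed.

Lemma reflectK : involutive reflect.
Proof. by move=> w; apply/funext => -[x|] //=; rewrite opprK. Qed.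

Lemma hand_shiftK b : cancel (hand_shift (~~ b)) (hand_shift b).
Proof.
move=> w; apply/funext => -[x|] //=.
by rewrite (_ : ~~ b == w None = ~~ (b == w None)) ?arrow_negb ?addrK//; case: b; case: (w None).
Qed.

Lemma measurable_swap : measurable_fun setT swap.
Proof. by rewrite swap_relabel; exact: measurable_relabel. Qed.

Lemma measurable_step e : measurable_fun setT (step e).
Proof. by rewrite step_relabel; exact: measurable_relabel. Qed.

Lemma measurable_reflect : measurable_fun setT reflect.
Proof. by rewrite reflect_relabel; exact: measurable_relabel. Qed.

Lemma measurable_hand_shift b : measurable_fun setT (hand_shift b).
Proof.
apply: measurable_to_config => x.
rewrite (_ : (fun t => _) = (fun w : config => if b == w None then step true w x else step false w x)).
  apply: measurable_fun_ifT.
  - apply: (measurableT_comp (f := eq_op b)) => //; exact: measurable_eval.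
  - exact: (measurableT_comp (measurable_eval x) (measurable_step true)).
  - exact: (measurableT_comp (measurable_eval x) (measurable_step false)).
by apply/funext => w; rewrite /hand_shift /step; case: ifP.
Qed.

Context (mu : probability config R) (hmu : iid_uniform mu id).

Lemma expect_swap (f : config -> R) : bounded_measurable f ->
  expect mu (fun w => f (swap w)) = expect mu f.
Proof.
by move=> bf; rewrite swap_relabel; exact: (expect_relabel _ swap_siteK swap_siteK hmu bf).
Qed.

Lemma expect_step e (f : config -> R) : bounded_measurable f ->
  expect mu (fun w => f (step e w)) = expect mu f.
Proof.
move=> bf; rewrite step_relabel.
apply: (expect_relabel (p' := omap (fun y => y - arrow e)) _ _ _ hmu bf).
- by move=> [x|] //=; rewrite addrK.
- by move=> [x|] //=; rewrite subrK.
Qed.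

Lemma expect_reflect (f : config -> R) : bounded_measurable f ->
  expect mu (fun w => f (reflect w)) = expect mu f.
Proof.
move=> bf; rewrite reflect_relabel.
by apply: (expect_relabel (p' := omap -%R) _ _ _ hmu bf) => -[x|] //=; rewrite opprK.
Qed.

Lemma expect_flip x (f : config -> R) : bounded_measurable f ->
  expect mu (fun w => f (flip x w)) = expect mu f.
Proof. by move=> bf; exact: (expect_relabel (p' := id) _ _ _ hmu bf). Qed.

(** Observables that are odd in some arrow have mean zero: this yields all the
    orthogonality relations between products of arrows. *)
Lemma expect_flip0 x (f : config -> R) : bounded_measurable f ->
  (forall w, f (flip x w) = - f w) -> expect mu f = 0.
Proof.
move=> bf fN; have := expect_flip x bf.
under [X in expect mu X]eq_fun do rewrite fN -mulN1r.
by rewrite expectZ//; lra.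
Qed.

Lemma bounded_measurable_comp (phi : config -> config) (f : config -> R) :
  measurable_fun setT phi -> bounded_measurable f ->
  bounded_measurable (fun w => f (phi w)).
Proof.
move=> mphi [mf [M fM]]; split; last by exists M.
exact: measurableT_comp.
Qed.

Lemma bounded_measurable_bool x (g : bool -> R) :
  bounded_measurable (fun w : config => g (w x)).
Proof.
split; last first.
  by exists (`|g true| + `|g false|) => w; case: (w x); rewrite ?lerDl ?lerDr.
by apply: (measurableT_comp (f := g)) => //; exact: measurable_eval.
Qed.

(** The shift never changes the hand arrow; given its value the map is a fixed
    translation. *)
Lemma expect_hand_shift b (f : config -> R) : bounded_measurable f ->
  expect mu (fun w => f (hand_shift b w)) = expect mu f.
Proof.
(* On the event that the hand arrow is c the map is the translation by
   [arrow (b == c)]. *)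
move=> bf; pose F (c : bool) (w : config) : R := (w None == c)%:R * f w.
have bF c : bounded_measurable (F c).
  apply: bounded_measurableM => //.
  exact: (bounded_measurable_bool None (fun a => (a == c)%:R)).
have bF' c : bounded_measurable (fun w => F c (step (b == c) w)).
  exact: bounded_measurable_comp (measurable_step _) (bF c).
transitivity (expect mu (fun w => F true (step (b == true) w) + F false (step (b == false) w))).
  congr (expect mu _); apply/funext => w; rewrite /F /hand_shift /step /=.
  by case: (w None); rewrite /= mul1r mul0r ?addr0 ?add0r.
rewrite expectD// !expect_step// -expectD//; congr (expect mu _); apply/funext => w.
by rewrite /F; case: (w None); rewrite /= mul1r mul0r ?addr0 ?add0r.
Qed.

End config_maps.

(** * The observables on configurations *)

Section concrete_arrow_space.
Context {R : realType}.

Section composition.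
Context (phi : config -> config) (mphi : measurable_fun setT phi).

Definition compose (F : bdm_fun R config) : bdm_fun R config :=
  bdm_of (bounded_measurable_comp mphi (bdm_funP F)).

Lemma compose_linear : linear compose.
Proof. by move=> a F G; apply: bdm_ext => w. Qed.

HB.instance Definition _ := GRing.isLinear.Build R _ _ _ compose compose_linear.

End composition.

Definition arrow_fun (x : option int) : bdm_fun R config :=
  bdm_of (bounded_measurable_bool x sgn).

Definition pair_fun (x y : option int) : bdm_fun R config :=
  bdm_of (bounded_measurableM (bdm_funP (arrow_fun x)) (bdm_funP (arrow_fun y))).

Context (mu : probability config R) (hmu : iid_uniform mu id).

Definition inner (F G : bdm_fun R config) : R := expect mu (fun w => F w * G w).

Lemma bounded_prod (F G : bdm_fun R config) : bounded_measurable (fun w => F w * G w).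
Proof. exact: bounded_measurableM (bdm_funP F) (bdm_funP G). Qed.

Lemma innerC F G : inner F G = inner G F.
Proof. by congr (expect mu _); apply/funext => w; rewrite mulrC. Qed.

Lemma innerDl F G H : inner (F + G) H = inner F H + inner G H.
Proof.
rewrite /inner -(expectD _ (bounded_prod _ _) (bounded_prod _ _)).
by congr (expect mu _); apply/funext => w; rewrite -mulrDl.
Qed.

Lemma innerZl a F H : inner (a *: F) H = a * inner F H.
Proof.
rewrite /inner -(expectZ _ _ (bounded_prod _ _)).
by congr (expect mu _); apply/funext => w; rewrite mulrA.
Qed.

Lemma inner_ge0 F : 0 <= inner F F.
Proof. by apply: expect_ge0 => w; rewrite -expr2 sqr_ge0. Qed.

Lemma inner_compose phi mphi :
  (forall f : config -> R, bounded_measurable f ->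
    expect mu (fun w => f (phi w)) = expect mu f) ->
  forall F G, inner (@compose phi mphi F) (compose mphi G) = inner F G.
Proof. by move=> h F G; rewrite /inner -(h _ (bounded_prod F G)). Qed.

Lemma sgn_flip x y w : sgn (flip x w y) = (if y == x then -1 else 1) * sgn (w y) :> R.
Proof. by rewrite /flip /relabel; case: (y == x); case: (w y); rewrite /sgn/=; lra. Qed.

Lemma inner_arrow x y : inner (arrow_fun x) (arrow_fun y) = (x == y)%:R.
Proof.
have [->|xy] := eqVneq x y.
  by rewrite /inner -[RHS](expect_cst mu); congr (expect mu _); apply/funext => w; exact: sgn2.
apply: (expect_flip0 hmu (x := x) (bounded_prod _ _)) => w.
by rewrite /= !sgn_flip eqxx eq_sym (negbTE xy); ring.
Qed.

Lemma inner_pairN x y :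
  inner (pair_fun None (Some x)) (pair_fun None (Some y)) = (x == y)%:R.
Proof.
rewrite (_ : (x == y)%:R = inner (arrow_fun (Some x)) (arrow_fun (Some y))).
  congr (expect mu _); apply/funext => w /=.
  by rewrite mulrACA sgn2 mul1r.
by rewrite inner_arrow.
Qed.

(** Of two distinct increasing pairs, one contains a site that the other does not. *)
Lemma inner_pair x y x' y' : x < y -> x' < y' ->
  inner (pair_fun (Some x) (Some y)) (pair_fun (Some x') (Some y')) =
  ((x == x') && (y == y'))%:R.
Proof.
move=> xy xy'.
have flipz z : (z == x) (+) (z == y) (+) (z == x') (+) (z == y') ->
    inner (pair_fun (Some x) (Some y)) (pair_fun (Some x') (Some y')) = 0.
  move=> h; apply: (expect_flip0 hmu (x := Some z) (bounded_prod _ _)) => w.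
  rewrite /= !sgn_flip; move: h; rewrite !(inj_eq Some_inj) !(eq_sym z).
  by case: (x == z); case: (y == z); case: (x' == z); case: (y' == z) => //= _; ring.
have [xx|xx] := eqVneq x x'.
  have [yy|yy] := eqVneq y y'.
    rewrite -xx -yy /inner -[RHS](expect_cst mu); congr (expect mu _).
    by apply/funext => w /=; rewrite mulrACA !sgn2 mulr1.
  rewrite (flipz y)//; lia.
have [xy2|xy2] := eqVneq x y'.
  rewrite (flipz x')//; lia.
rewrite (flipz x)//; lia.
Qed.

Lemma reflect_swap w : reflect (swap w) = swap (reflect w).
Proof.
apply/funext => -[x|] //=; rewrite /swap /reflect/= !(inj_eq Some_inj) oppr_eq0.
by case: ifP.
Qed.

Lemma reflect_step b w : step b (reflect w) = reflect (step (~~ b) w).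
Proof. by apply/funext => -[x|] //=; rewrite arrow_negb opprD. Qed.

Lemma reflect_hand_shift b w :
  hand_shift b (reflect w) = reflect (hand_shift (~~ b) w).
Proof.
apply/funext => -[x|] //=; rewrite opprD -arrow_negb; congr (w (Some (_ + arrow _))).
by case: b; case: (w None).
Qed.

Lemma swap_arrow x : x != 0 -> compose measurable_swap (arrow_fun (Some x)) = arrow_fun (Some x).
Proof.
by move=> x0; apply: bdm_ext => w /=; rewrite /swap (inj_eq Some_inj) (negbTE x0).
Qed.

Lemma hand_shift_arrow x :
  compose (measurable_hand_shift false) (arrow_fun (Some x)) =
    2^-1 *: (arrow_fun (Some (x - 1)) + arrow_fun (Some (x + 1)))
    + 2^-1 *: (pair_fun None (Some (x - 1)) - pair_fun None (Some (x + 1))).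
Proof.
apply: bdm_ext => w.
rewrite [RHS](_ : _ = 2^-1 * (sgn (w (Some (x - 1))) + sgn (w (Some (x + 1))))
    + 2^-1 * (sgn (w None) * sgn (w (Some (x - 1)))
              - sgn (w None) * sgn (w (Some (x + 1)))))//.
rewrite [LHS]/= /hand_shift/=.
by case: (w None) => /=; rewrite ?[sgn true]/sgn ?[sgn false]/sgn; field.
Qed.

Lemma swap_pair x : x != 0 ->
  compose measurable_swap (pair_fun None (Some x)) = pair_fun (Some 0) (Some x).
Proof.
by move=> x0; apply: bdm_ext => w /=; rewrite /swap/= (inj_eq Some_inj) (negbTE x0).
Qed.

(** Transparent, so that [ip], [ar] and the operations compute to functions on
    configurations. *)
Definition config_space : arrow_space R.
Proof.
refine (@ArrowSpace R (bdm_fun R config) inner innerC innerDl innerZl inner_ge0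
  (compose measurable_swap) (compose measurable_reflect)
  (fun b => compose (measurable_step b)) (fun b => compose (measurable_hand_shift b))
  _ _ _ _ _ _ _ _ _ _ _ arrow_fun pair_fun _ _ _ _ _ _ _ hand_shift_arrow
  swap_pair _ _ inner_arrow inner_pairN inner_pair).
- by apply: inner_compose => f; exact: expect_swap.
- by apply: inner_compose => f; exact: expect_reflect.
- by move=> b; apply: inner_compose => f; exact: expect_step.
- by move=> b; apply: inner_compose => f; exact: expect_hand_shift.
- by move=> F; apply: bdm_ext => w /=; rewrite swapK.
- by move=> F; apply: bdm_ext => w /=; rewrite reflectK.
- by move=> b F; apply: bdm_ext => w /=; rewrite stepK.
- by move=> b F; apply: bdm_ext => w /=; rewrite hand_shiftK.
- by move=> F; apply: bdm_ext => w /=; rewrite reflect_swap.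
- by move=> b F; apply: bdm_ext => w /=; rewrite reflect_step.
- by move=> b F; apply: bdm_ext => w /=; rewrite reflect_hand_shift.
- by apply: bdm_ext.
- exact: swap_arrow.
- by apply: bdm_ext.
- by move=> x; apply: bdm_ext.
- by move=> b; apply: bdm_ext.
- by move=> b x; apply: bdm_ext.
- by move=> b; apply: bdm_ext.
- by move=> x; apply: bdm_ext.
- by move=> x y; apply: bdm_ext.
Defined.

Lemma gen_op_config_space (m : model) (eps : R) (F : config_space) w :
  (gen_op (if m is M2 then true else false) eps F : bdm_fun R config) w
  = env_generator m eps F w.
Proof.
rewrite /env_generator /generator /opU big_bool /gen_op /env_op /jump_op !avgE.
pose f : config -> R := (F : bdm_fun R config).
pose A (tau : config -> config) : R :=
  2^-1 * (2^-1 * (f (tau w) + f (swap (tau w)))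
          + 2^-1 * (f (tau (swap w)) + f (swap (tau (swap w))))).
have AE tau : A tau - f w = opTtilde swap tau f w by rewrite /A /opTtilde; field.
pose u : R := 2^-1 * (A (step true) + A (step false)) - f w.
have uE : u = 2^-1 * (opTtilde swap (step true) f w + opTtilde swap (step false) f w).
  by rewrite /u -!AE; field.
case: m.
- rewrite [LHS](_ : _ = f (swap (hand_step w)) - f w + eps * u); last by [].
  by rewrite uE.
- rewrite [LHS](_ : _ = A hand_step - f w + eps * u); last by [].
  by rewrite uE AE.
Qed.

End concrete_arrow_space.

(** * Generators with bounded rates *)

Section generator_theory.
Context {R : realType} {S : Type}.
Variables (sw : S -> S) (st : bool -> S -> S) (hst : S -> S).
Variables (m : model) (eps : R).
Implicit Types f g : S -> R.
Local Notation L := (generator sw st hst m eps).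

(** Contains every jump of both models, so that the locality and boundedness of the
    generator are proved for both at once. *)
Definition reach (z z' : S) : Prop := exists z0 z1,
  [/\ z0 = z \/ z0 = sw z, z1 = hst z0 \/ (exists e, z1 = st e z0) &
      z' = z1 \/ z' = sw z1].

Lemma generatorB f g z : L (fun y => f y - g y) z = L f z - L g z.
Proof. by rewrite /generator /opU !big_bool /=; case: m; rewrite /opT /opTtilde; ring. Qed.

Lemma generator_cst a z : L (fun=> a) z = 0.
Proof. by rewrite /generator /opU big_bool /=; case: m; rewrite /opT /opTtilde; field. Qed.

(** The total rate of the optional jumps is 1 + eps, and adding it back leaves an
    average over reachable states. *)
Lemma generator_bound f z M : 0 <= eps ->
  (forall z', reach z z' -> `|f z'| <= M) ->
  `|L f z + (1 + eps) * f z| <= (1 + eps) * M.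
Proof.
move=> eps0 fM.
have B tau : (forall y, tau y = hst y \/ exists e, tau y = st e y) ->
  [/\ `|f (tau z)| <= M, `|f (sw (tau z))| <= M, `|f (tau (sw z))| <= M &
      `|f (sw (tau (sw z)))| <= M].
  move=> ht; split; apply: fM.
  - by exists z, (tau z); split; [left|exact: ht|left].
  - by exists z, (tau z); split; [left|exact: ht|right].
  - by exists (sw z), (tau (sw z)); split; [right|exact: ht|left].
  - by exists (sw z), (tau (sw z)); split; [right|exact: ht|right].
have T tau : (forall y, tau y = hst y \/ exists e, tau y = st e y) ->
    `|opTtilde sw tau f z + f z| <= M.
  by move=> /B[]; rewrite /opTtilde !ler_norml => /andP[? ?] /andP[? ?] /andP[? ?] /andP[? ?]; apply/andP; split; lra.
have T1 : `|match m with M1 => opT sw hst f z | M2 => opTtilde sw hst f z end + f z| <= M.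
  case: m; last by apply: T; left.
  by rewrite /opT subrK; case: (B hst) => //; left.
have T2 e : `|opTtilde sw (st e) f z + f z| <= M by apply: T; right; exists e.
have -> : L f z + (1 + eps) * f z =
    (match m with M1 => opT sw hst f z | M2 => opTtilde sw hst f z end + f z)
    + eps * (2^-1 * ((opTtilde sw (st true) f z + f z) + (opTtilde sw (st false) f z + f z))).
  by rewrite /generator /opU big_bool /=; field.
rewrite mulrDl mul1r (le_trans (ler_normD _ _))// lerD// normrM ger0_norm// ler_wpM2l//.
move: (T2 true) (T2 false); rewrite !ler_norml => /andP[? ?] /andP[? ?].
by apply/andP; split; lra.
Qed.

Lemma generator_local f g z : 0 <= eps ->
  f z = g z -> (forall z', reach z z' -> f z' = g z') -> L f z = L g z.
Proof.
move=> eps0 fgz fg; apply/eqP; rewrite -subr_eq0 -generatorB -normr_le0.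
have /(generator_bound eps0) : forall z', reach z z' -> `|f z' - g z'| <= 0.
  by move=> z' /fg ->; rewrite subrr normr0.
by rewrite fgz subrr !mulr0 addr0.
Qed.

Lemma generator_increment_bound f z M : 0 <= eps ->
  (forall z', reach z z' -> `|f z' - f z| <= M) -> `|L f z| <= (1 + eps) * M.
Proof.
move=> eps0 /(generator_bound eps0).
by rewrite subrr mulr0 addr0 (generatorB f (fun=> f z)) generator_cst subr0.
Qed.

Lemma generator_cvg (f_ : nat -> S -> R) f z :
  (forall y, f_ n y @[n --> \oo] --> f y) -> L (f_ n) z @[n --> \oo] --> L f z.
Proof.
move=> h.
have T tau : opTtilde sw tau (f_ n) z @[n --> \oo] --> opTtilde sw tau f z.
  by apply: cvgB; [do 3?[apply: cvgD]; apply: cvgMr; exact: h | exact: h].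
rewrite /generator; apply: cvgD.
  case: m; last exact: T.
  by rewrite /opT; apply: cvgB; exact: h.
apply: cvgMr; rewrite /opU; apply: cvgMr.
under eq_fun do rewrite big_bool.
by rewrite big_bool; apply: cvgD; exact: T.
Qed.

End generator_theory.

Section generator_measurable.
Context {R : realType} {d : measure_display} {S : measurableType d}.
Variables (sw : S -> S) (st : bool -> S -> S) (hst : S -> S).
Hypotheses (msw : measurable_fun setT sw) (mst : forall e, measurable_fun setT (st e))
  (mhst : measurable_fun setT hst).
Variables (m : model) (eps : R).

Lemma measurable_generator (f : S -> R) : measurable_fun setT f ->
  measurable_fun setT (generator sw st hst m eps f).
Proof.
move=> mf.
have C (tau : S -> S) : measurable_fun setT tau -> measurable_fun setT (fun z => f (tau z)).
  by move=> mtau; exact: measurableT_comp.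
have T tau : measurable_fun setT tau -> measurable_fun setT (opTtilde sw tau f).
  move=> mtau; apply: measurable_funB => //.
  have h (rho : S -> S) : measurable_fun setT rho -> measurable_fun setT (fun z => 4^-1 * f (rho z)).
    by move=> mrho; apply: measurable_funM => //; exact: C.
  do 3?[apply: measurable_funD]; apply: h; do ?[exact: mtau|exact: msw].
  - exact: (measurableT_comp msw mtau).
  - exact: (measurableT_comp mtau msw).
  - exact: (measurableT_comp msw (measurableT_comp mtau msw)).
apply: measurable_funD.
  case: m; last exact: T.
  by apply: measurable_funB => //; apply: C; exact: (measurableT_comp msw mhst).
apply: measurable_funM => //; apply: measurable_funM => //.
rewrite (_ : (fun x => _) = (fun z => opTtilde sw (st true) f z + opTtilde sw (st false) f z)).
  by apply: measurable_funD; exact: T.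
by apply/funext => z; rewrite big_bool.
Qed.

Lemma bounded_measurable_generator (f : S -> R) : 0 <= eps -> bounded_measurable f ->
  bounded_measurable (generator sw st hst m eps f).
Proof.
move=> eps0 [mf [M fM]]; split; first exact: measurable_generator.
exists ((1 + eps) * (M + M)) => z; apply: generator_increment_bound => // z' _.
by rewrite (le_trans (ler_normB _ _))// lerD.
Qed.

(** The resolvent equation is a fixed-point equation for the jump chain killed at
    rate lam, a contraction of ratio (1 + eps) / (lam + 1 + eps).  The iteration
    is carried out pointwise, which keeps the limit bounded and measurable. *)
Lemma resolvent_exists (lam : R) (f : S -> R) : 0 <= eps -> 0 < lam -> bounded_measurable f ->
  exists2 psi, bounded_measurable psi &
    forall z, lam * psi z - generator sw st hst m eps psi z = f z.
Proof.
move=> eps0 lam0 [mf [M fM]].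
pose L := @generator R S sw st hst m eps.
pose k := lam + (1 + eps).
have k0 : 0 < k by rewrite /k; lra.
have nk : `|k^-1| = k^-1 by rewrite ger0_norm// invr_ge0 ltW.
pose next (u : S -> R) z := (L u z + (1 + eps) * u z + f z) / k.
pose u n := iter n next (fun=> 0).
have mu n : measurable_fun setT (u n).
  elim: n => [|n IHn] //=; apply: measurable_funM => //.
  apply: measurable_funD => //; apply: measurable_funD; first exact: measurable_generator.
  by apply: measurable_funM.
have bu n z : `|u n z| <= M / lam.
  elim: n z => [|n IHn] z /=.
    have M0 : 0 <= M := le_trans (normr_ge0 _) (fM z).
    by rewrite normr0 divr_ge0// ltW.
  rewrite /next normrM nk ler_pdivrMr//.
  rewrite (le_trans (ler_normD _ _))//.
  apply: (@le_trans _ _ ((1 + eps) * (M / lam) + M)); last first.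
    rewrite (_ : (1 + eps) * (M / lam) + M = M / lam * k)//.
    by rewrite /k; field; rewrite gt_eqF.
  by rewrite lerD//; apply: generator_bound.
pose rho := (1 + eps) / k.
have rho0 : 0 <= rho by rewrite divr_ge0 ?ltW//; lra.
have rho1 : rho < 1 by rewrite ltr_pdivrMr// mul1r /k; lra.
have du n z : `|u n.+1 z - u n z| <= M / k * rho ^+ n.
  elim: n z => [|n IHn] z.
    rewrite expr0 mulr1 /= /next subr0 /L generator_cst mulr0 !add0r normrM.
    by rewrite nk ler_wpM2r// invr_ge0 ltW.
  have -> : u n.+2 z - u n.+1 z = (L (fun y => u n.+1 y - u n y) z
       + (1 + eps) * (u n.+1 z - u n z)) / k.
    by rewrite /L generatorB -/L /= /next; ring.
  rewrite normrM nk ler_pdivrMr//.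
  apply: (le_trans (@generator_bound R S sw st hst m eps
    (fun y => u n.+1 y - u n y) z (M / k * rho ^+ n) eps0 (fun z' _ => IHn z'))).
  by rewrite exprS /rho le_eqVlt; apply/orP; left; apply/eqP; field; rewrite gt_eqF.
have cu z : cvgn (u ^~ z).
  have : cvgn (series (fun n => u n.+1 z - u n z)).
    apply: normed_cvg; apply: (@series_le_cvg _ _ (fun n => M / k * rho ^+ n)) => //.
    - by move=> n /=; exact: normr_ge0.
    - by move=> n; exact: le_trans (normr_ge0 _) (du n z).
    - by move=> n; exact: du.
    by apply: is_cvg_geometric_series; rewrite ger0_norm.
  by rewrite (_ : series _ = u ^~ z)//; apply/funext => n; rewrite /series/= telescope_sumr// subr0.
pose psi z := limn (u ^~ z).
have upsi z : u n z @[n --> \oo] --> psi z by exact: cu.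
have mpsi : measurable_fun setT psi.
  by apply: (@measurable_fun_cvg _ _ _ setT u) => // z _; exact: upsi.
exists psi.
  split => //; exists (M / lam) => z.
  apply: (cvgr_to_le (cvg_norm (upsi z))).
  by apply: nearW => n; exact: bu.
move=> z.
have h : next psi z = psi z.
  have h1 : next (u n) z @[n --> \oo] --> next psi z.
    apply: cvgMl; apply: cvgD; last exact: cvg_cst.
    apply: cvgD; first exact: generator_cvg.
    by apply: cvgMr; exact: upsi.
  have h2 : u n.+1 z @[n --> \oo] --> psi z by rewrite (cvg_shiftS (u ^~ z)); exact: upsi.
  exact: (cvg_unique _ h1 h2).
move: h; rewrite /next => /(congr1 (fun x => x * k)); rewrite divfK ?gt_eqF// /k /L => h.
lra.
Qed.

End generator_measurable.

(** * The process at an exponential time *)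

Section exponential_time.
Context {R : realType}.
Local Notation leb := (@lebesgue_measure R).

(** The exponential distribution on the copy of the reals whose sigma-algebra enters
    product measures. *)
Definition exponential_law (lam : R) (lam0 : 0 < lam) : probability (measurableTypeR R) R.
Proof. unshelve refine (exponential_prob lam : probability _ R). exact: lam0. Defined.

(** The density is a Radon-Nikodym derivative of the law with respect to the Lebesgue
    measure, which gives the change of variables. *)
Lemma integral_exponential_law (lam : R) (lam0 : 0 < lam)
    (f : measurableTypeR R -> \bar R) :
  measurable_fun setT f -> (forall t, (0 <= f t)%E) ->
  (\int[exponential_law lam0]_t f t =
   \int[leb]_(t in `[0%R, +oo[) (f t * (lam * expR (- (lam * t)))%:E))%E.
Proof.
move=> mf f0; pose E := exponential_law lam0.
have mpdf : measurable_fun setT (fun t => (exponential_pdf lam t)%:E).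
  by apply/measurable_EFinP; exact: measurable_exponential_pdf.
have pdf0 t : (0 <= (exponential_pdf lam t)%:E)%E.
  by rewrite lee_fin exponential_pdf_ge0// ltW.
have dom : E `<< leb.
  apply/null_content_dominatesP => A mA A0; rewrite /E/= /exponential_prob.
  by apply: null_set_integral => //; exact: measurable_funTS.
have ae : ae_eq leb setT (Radon_Nikodym_SigmaFinite.f E leb)
    (fun t => (exponential_pdf lam t)%:E).
  apply: integral_ae_eq => //.
  - exact: Radon_Nikodym_SigmaFinite.f_integrable.
  - move=> A _ mA; rewrite -Radon_Nikodym_SigmaFinite.f_integral//.
rewrite -(Radon_Nikodym_SigmaFinite.change_of_variables dom f0 measurableT mf).
transitivity (\int[leb]_t (f t * (exponential_pdf lam t)%:E))%E.
  apply: ge0_ae_eq_integral => //.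
  - apply: emeasurable_funM => //; apply: measurable_int.
    exact: Radon_Nikodym_SigmaFinite.f_integrable dom.
  - exact: emeasurable_funM.
  - by move=> t _; rewrite mule_ge0//; exact: Radon_Nikodym_SigmaFinite.f_ge0.
  - by move=> t _; rewrite mule_ge0.
  - exact: ae_eqe_mul2l.
rewrite [RHS]integral_mkcond; apply: eq_integral => t _; rewrite /exponential_pdf.
by rewrite !patchE; case: ifPn => // _; rewrite ?mule0// mulNr.
Qed.

End exponential_time.

Section joint_measurability.
Context {R : realType} {d dS : measure_display} {T : measurableType d} {S : measurableType dS}.
Variable Z : R -> T -> S.
Hypothesis mZ : forall t, 0 <= t -> measurable_fun setT (Z t).
Hypothesis pZ : jump_paths Z.

(** The next multiple of 1 / (n + 1) strictly after t: paths are continuous from the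
    right, so the path has to be approached from that side. *)
Definition grid (n : nat) (t : R) : R := (Num.truncn (n.+1%:R * t)).+1%:R / n.+1%:R.

Lemma grid_bounds n t : 0 <= t -> t < grid n t <= t + n.+1%:R^-1.
Proof.
move=> t0; have n0 : 0 < n.+1%:R :> R by rewrite ltr0n.
have := truncn_itv (mulr_ge0 (ltW n0) t0).
rewrite /grid ltr_pdivlMr// ler_pdivrMr// mulrDl mulVf ?gt_eqF// => /andP[h1 h2].
by rewrite (mulrC t) h2 -natr1 lerD2r h1.
Qed.

Lemma path_on_grid t w : 0 <= t -> \forall n \near \oo, Z (grid n t) w = Z t w.
Proof.
move=> t0; have [h _] := pZ w t0.
case: h => e /= e0 h.
have [N hN] : exists N : nat, N.+1%:R^-1 < e.
  exists (Num.truncn e^-1); rewrite invf_plt ?posrE//.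
  by have /andP[] := truncn_itv (ltW (etrans (invr_gt0 e) e0)).
exists N => // n /= Nn; have /andP[g1 g2] := grid_bounds n t0.
apply: h => //=; rewrite ltr0_norm ?subr_lt0// opprB ltrBlDl.
apply: (le_lt_trans g2); rewrite ltrD2l; apply: le_lt_trans hN.
by rewrite lef_pV2 ?posrE// ler_nat.
Qed.

(** Defined at all times, since the exponential law lives on the whole line. *)
Definition path_map (z : measurableTypeR R * T) : S := Z (Num.max 0 z.1) z.2.

(** Right-continuous step paths are eventually equal to their values on the grid, and
    on the grid only countably many times occur. *)
Lemma measurable_path_map : measurable_fun setT path_map.
Proof.
move=> _ B mB; rewrite setTI.
pose G n : set (measurableTypeR R * T) := [set z | B (Z (grid n (Num.max 0 z.1)) z.2)].
have mG n : measurable (G n).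
  rewrite (_ : G n = \bigcup_k
    ([set t | Num.truncn (n.+1%:R * Num.max 0 t) = k] `*` (Z (k.+1%:R / n.+1%:R) @^-1` B))).
    apply: bigcupT_measurable => k; apply: measurableX.
      have mm : measurable_fun setT (fun t : measurableTypeR R => n.+1%:R * Num.max 0 t).
        by apply: measurable_funM => //; exact: measurable_maxr.
      rewrite (_ : [set t | _] = setT `&` (fun t : R => n.+1%:R * Num.max 0 t) @^-1` `[k%:R, k.+1%:R[%classic).
        by apply: mm.
      rewrite setTI; apply/seteqP; split=> t /=.
        by move=> <-; rewrite in_itv/= truncn_itv// mulr_ge0// le_max lexx.
      by rewrite in_itv/= => /truncn_def.
    rewrite -[X in measurable X]setTI.
    exact: (mZ (divr_ge0 (ler0n _ _) (ler0n _ _)) measurableT mB).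
  apply/seteqP; split=> [[t w]/= h|[t w] [k _] [/= <-]//].
  by exists (Num.truncn (n.+1%:R * Num.max 0 t)).
rewrite (_ : _ @^-1` B = \bigcup_N \bigcap_(n in [set n | (N <= n)%N]) G n).
  apply: bigcupT_measurable => N; apply: bigcap_measurable; first by exists N => /=.
  by move=> k _; exact: mG.
apply/seteqP; split=> -[t w]; rewrite /path_map/=.
  move=> h; have t0 : 0 <= Num.max 0 t by rewrite le_max lexx.
  have [N _ hN] := path_on_grid w t0.
  by exists N => // n /= Nn; rewrite /G/= hN.
move=> [N _ hN]; have t0 : 0 <= Num.max 0 t by rewrite le_max lexx.
have [N' _ hN'] := path_on_grid w t0.
have := hN (maxn N N') (leq_maxl _ _); rewrite /G/= hN'//=; exact: leq_maxr.
Qed.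

End joint_measurability.

Section occupation.
Context {R : realType} {d dS : measure_display} {T : measurableType d} {S : measurableType dS}.
Variable Z : R -> T -> S.
Hypothesis mZ : forall t, 0 <= t -> measurable_fun setT (Z t).
Hypothesis pZ : jump_paths Z.
Variable P : probability T R.
Local Notation leb := (@lebesgue_measure R).

(** The law of the process at an independent exponential time, i.e. the image of a
    product measure; Tonelli's theorem computes its integrals. *)
Lemma occupation_law (lam : R) : 0 < lam -> exists nu : probability S R,
  forall f : S -> R, measurable_fun setT f -> (forall z, 0 <= f z) ->
    (\int[nu]_z (f z)%:E =
     \int[leb]_(t in `[0%R, +oo[)
       ((\int[P]_w (f (Z t w))%:E) * (lam * expR (- (lam * t)))%:E))%E.
Proof.
move=> lam0; pose E := exponential_law lam0.
pose W : {mfun (measurableTypeR R * T)%type >-> S} :=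
  HB.pack (path_map Z) (isMeasurableFun.Build _ _ _ _ _ (measurable_path_map mZ pZ)).
exists (distribution (E \x P)%E W) => f mf f0.
have mfW : measurable_fun setT (fun x => (f (path_map Z x))%:E : \bar R).
  apply/measurable_EFinP; apply: measurableT_comp => //; exact: measurable_path_map.
have mfE : measurable_fun setT (fun z => (f z)%:E : \bar R) by exact/measurable_EFinP.
have f0E z : (0 <= (f z)%:E)%E by rewrite lee_fin.
rewrite (ge0_integral_distribution W mfE f0E) fubini_tonelli1//; last by move=> y; exact: f0E.
rewrite (integral_exponential_law lam0); last 2 first.
- by apply: measurable_fun_fubini_tonelli_F => // x; exact: f0E.
- by move=> t; apply: integral_ge0 => w _; exact: f0E.
apply: eq_integral => t; rewrite inE/= in_itv/= andbT => t0.
by rewrite /fubini_F /path_map/= max_r.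
Qed.

End occupation.

Section pullback_kernel.
Context {R : realType} {d d1 d2 : measure_display} {T : measurableType d}
  {S : measurableType d1} {S' : measurableType d2}.
Variables (k : R.-pker S ~> S') (f : T -> S).

(** The kernel as seen from the sample space, with a dummy first argument as required
    by kernel composition. *)
Definition pullback_kernel (mf : measurable_fun setT f) (x : unit * T) :
  {measure set S' -> \bar R} := k (f x.2).

Hypothesis mf : measurable_fun setT f.

Let measurable_pullback U : measurable U -> measurable_fun setT (pullback_kernel mf ^~ U).
Proof.
move=> mU; rewrite /pullback_kernel.
apply: (measurableT_comp (measurable_kernel k U mU)).
exact: (measurableT_comp mf measurable_snd).
Qed.

HB.instance Definition _ := isKernel.Build _ _ _ _ _ (pullback_kernel mf) measurable_pullback.

Let pullback_prob x : pullback_kernel mf x setT = 1%E.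
Proof. exact: prob_kernel. Qed.

HB.instance Definition _ := Kernel_isProbability.Build _ _ _ _ _ (pullback_kernel mf) pullback_prob.

End pullback_kernel.

Section kernel_at.
Context {R : realType} {d1 d2 : measure_display} {S : measurableType d1}
  {S' : measurableType d2} (k : R.-pker S ~> S') (z : S).

(** The measure given by a probability kernel at one point, as a probability. *)
Definition kernel_at : set S' -> \bar R := k z.

HB.instance Definition _ := isMeasure.Build _ _ _ kernel_at
  (measure0 (k z)) (measure_ge0 (k z)) (@measure_semi_sigma_additive _ _ _ (k z)).

Let kernel_at_setT : kernel_at setT = 1%E.
Proof. exact: prob_kernel. Qed.

HB.instance Definition _ := Measure_isProbability.Build _ _ _ kernel_at kernel_at_setT.

End kernel_at.

Section markov_expectation.
Context {R : realType} {d dS : measure_display} {T : measurableType d} {S : measurableType dS}.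
Variables (P : probability T R) (Z : R -> T -> S) (p : R -> R.-pker S ~> S).
Hypothesis mZ : forall t, 0 <= t -> measurable_fun setT (Z t).
Hypothesis markov : markov_property P p Z.

(** The Markov property with the trivial event says that the law at time s + t is the
    law at time s composed with the transition kernel. *)
Lemma markov_integral (s t : R) (f : S -> R) : 0 <= s -> 0 <= t ->
  measurable_fun setT f -> (forall z, 0 <= f z) ->
  (\int[P]_w (f (Z (s + t) w))%:E = \int[P]_w \int[p t (Z s w)]_y (f y)%:E)%E.
Proof.
move=> s0 t0 mf f0.
have mst := mZ (addr_ge0 s0 t0).
pose k := pullback_kernel (p t) (mZ s0).
(* P is seen as a constant kernel from the unit type, so that the law at time
   s + t is the composition of two kernels. *)
pose l := kprobability (@measurable_cst _ _ unit (pprobability T R) setT P).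
have mfE : measurable_fun setT (fun z => (f z)%:E : \bar R) by exact/measurable_EFinP.
have f0E z : (0 <= (f z)%:E)%E by rewrite lee_fin.
transitivity (\int[kcomp l k tt]_z (f z)%:E)%E; last exact: integral_kcomp f0E mfE.
pose W : {mfun T >-> S} := HB.pack (Z (s + t)) (isMeasurableFun.Build _ _ _ _ _ mst).
transitivity (\int[distribution P W]_z (f z)%:E)%E.
  by rewrite (ge0_integral_distribution W mfE f0E).
apply: eq_measure_integral => B mB _.
have /= := markov s0 t0 (A := setT) _ mB; rewrite setTI; apply.
exact: (@measurableT _ (g_sigma_algebraType _)).
Qed.

Lemma kernel_integralE t z (g : S -> R) :
  \int[p t z]_y g y = expect (kernel_at (p t) z) g.
Proof. by []. Qed.

Lemma kernel_integral_bounded (t : R) (g : S -> R) : bounded_measurable g ->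
  bounded_measurable (fun z => \int[p t z]_y g y).
Proof.
move=> bg; have [mg [M gM]] := bg; split; last first.
  exists M => z; rewrite kernel_integralE.
  exact: (expect_norm_le (kernel_at (p t) z) bg gM).
rewrite (_ : (fun z => _) = (fun z => fine (\int[p t z]_y (g y + M)%:E)%E - M)).
  apply: measurable_funB => //; apply: (measurableT_comp (f := fine)) => //.
  apply: measurable_fun_integral_kernel.
  - by move=> U mU; exact: measurable_kernel.
  - by move=> y; rewrite lee_fin; have := gM y; rewrite ler_norml => /andP[]; lra.
  - by apply/measurable_EFinP; exact: measurable_funD.
apply/funext => z; rewrite -[fine _]/(expect (kernel_at (p t) z) (fun y => g y + M)).
by rewrite expectD ?expect_cst ?addrK//; exact: bounded_measurable_cst.
Qed.

(** Adding a constant reduces a bounded function to a nonnegative one. *)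
Lemma markov_expect (s t : R) (g : S -> R) : 0 <= s -> 0 <= t ->
  bounded_measurable g ->
  expect P (fun w => g (Z (s + t) w)) = expect P (fun w => \int[p t (Z s w)]_y g y).
Proof.
move=> s0 t0 bg; have [mg [M gM]] := bg.
pose g' z := g z + M; have bg' : bounded_measurable g'.
  exact: bounded_measurableD bg (bounded_measurable_cst M).
have g'0 z : 0 <= g' z by have := gM z; rewrite ler_norml /g' => /andP[]; lra.
have bZ u (f : S -> R) : 0 <= u -> bounded_measurable f -> bounded_measurable (fun w => f (Z u w)).
  move=> u0 [mf [N fN]]; split; last by exists N.
  exact: measurableT_comp mf (mZ u0).
have st0 := addr_ge0 s0 t0.
have pint z : \int[p t z]_y g' y = \int[p t z]_y g y + M.
  by rewrite !kernel_integralE expectD ?expect_cst//; exact: bounded_measurable_cst.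
have E1 : expect P (fun w => g' (Z (s + t) w)) = expect P (fun w => g (Z (s + t) w)) + M.
  by rewrite -[in RHS](expect_cst P M) -expectD//; [exact: bZ|exact: bounded_measurable_cst].
have E2 : expect P (fun w => \int[p t (Z s w)]_y g' y) = expect P (fun w => \int[p t (Z s w)]_y g y) + M.
  under eq_fun do rewrite pint.
  rewrite expectD ?expect_cst//; last exact: bounded_measurable_cst.
  exact: (bZ s _ s0 (kernel_integral_bounded t bg)).
apply: (addIr M); rewrite -E1 -E2 /expect /Rintegral; congr fine.
rewrite markov_integral//; last by case: bg'.
apply: eq_integral => w _; rewrite fineK//.
exact: (integrable_fin_num measurableT
  (bounded_measurable_integrable (kernel_at (p t) (Z s w)) bg')).
Qed.

End markov_expectation.

(** * The resolvent identity *)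

Section resolvent_identity.
Context {R : realType} {d dS : measure_display} {T : measurableType d} {S : measurableType dS}.
Variables (P : probability T R) (Z : R -> T -> S) (p : R -> R.-pker S ~> S).
Variable L : (S -> R) -> S -> R.
Hypothesis mZ : forall t, 0 <= t -> measurable_fun setT (Z t).
Hypothesis pZ : jump_paths Z.
Hypothesis markov : markov_property P p Z.
Hypothesis genL : has_generator p L.
Hypothesis bL : forall g, bounded_measurable g -> bounded_measurable (L g).
Local Notation leb := (@lebesgue_measure R).

Let u (g : S -> R) (t : R) : R := expect P (fun w => g (Z t w)).

Let bZ (t : R) (g : S -> R) : 0 <= t -> bounded_measurable g ->
  bounded_measurable (fun w => g (Z t w)).
Proof.
move=> t0 [mg [M gM]]; split; last by exists M.
exact: measurableT_comp mg (mZ t0).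
Qed.

(** The generator is a uniform limit over states, so the error is uniform in time as
    well; this uniformity gives continuity and then differentiability in time. *)
Lemma expect_increment g (e : R) : bounded_measurable g -> 0 < e ->
  exists2 del, 0 < del & forall t h : R, 0 <= t -> 0 < h -> h < del ->
    `|u g (t + h) - u g t - h * u (L g) t| <= h * e.
Proof.
move=> bg e0; have [mg _] := bg.
have [del /= del0 H] := genL mg (bounded_measurable_bounded bg) e0.
exists del => // t h t0 h0 hdel.
have {}H z : `|h^-1 * (\int[p h z]_y g y - g z) - L g z| <= e.
  by apply: H => //=; rewrite sub0r normrN gtr0_norm.
have bG := kernel_integral_bounded p h bg.
have B1 := bZ t0 bG; have B2 := bZ t0 bg; have B3 := bZ t0 (bL bg).
rewrite {1}/u (markov_expect mZ markov t0 (ltW h0) bg) -/(u g t).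
rewrite -expectZ// -[u g t]mul1r -mulNr -expectZ// -expectD//; last exact: bounded_measurableZ.
rewrite -[X in _ - X]mul1r -mulNr -expectZ; last exact: bounded_measurableZ.
rewrite -expectD; last 2 first.
- apply: bounded_measurableD => //; exact: bounded_measurableZ.
- do 2 apply: bounded_measurableZ => //.
apply: expect_norm_le.
  apply: bounded_measurableD; first apply: bounded_measurableD => //; do ?apply: bounded_measurableZ => //.
move=> w; rewrite !mulN1r.
have -> : \int[p h (Z t w)]_y g y - g (Z t w) - h * L g (Z t w) =
    h * (h^-1 * (\int[p h (Z t w)]_y g y - g (Z t w)) - L g (Z t w)).
  by rewrite mulrBr mulrA divff ?gt_eqF// mul1r.
by rewrite normrM gtr0_norm// ler_pM2l.
Qed.

Lemma expect_lipschitz g : bounded_measurable g ->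
  exists M, 0 < M /\ exists2 del, 0 < del & forall t h : R, 0 <= t -> 0 < h -> h < del ->
    `|u g (t + h) - u g t| <= h * M.
Proof.
move=> bg; have [_ [M LM]] := bL bg.
have [del del0 H] := expect_increment bg ltr01.
exists (`|M| + 1); split; first by rewrite ltr_wpDl.
exists del => // t h t0 h0 hdel.
have v : `|u (L g) t| <= `|M|.
  apply: expect_norm_le; first exact: bZ t0 (bL bg).
  by move=> w; exact: le_trans (LM _) (ler_norm _).
have := H t h t0 h0 hdel; move: v.
rewrite mulrDr !ler_norml => /andP[v1 v2] /andP[h1 h2].
by apply/andP; split; nra.
Qed.

Lemma expect_near g (t e : R) : bounded_measurable g -> 0 <= t -> 0 < e ->
  exists2 del, 0 < del & forall t' : R, 0 <= t' -> `|t - t'| < del -> `|u g t - u g t'| <= e.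
Proof.
move=> bg t0 e0; have [M [M0 [del del0 H]]] := expect_lipschitz bg.
exists (Num.min del (e / M)); first by rewrite lt_min del0 divr_gt0.
move=> t' t'0; rewrite lt_min => /andP[h1 h2].
have key a b : 0 <= a -> a < b -> `|a - b| < del -> `|a - b| < e / M -> `|u g b - u g a| <= e.
  move=> a0 ab; rewrite distrC gtr0_norm ?subr_gt0// => hd he.
  have := H a (b - a) a0; rewrite subr_gt0 => /(_ ab hd); rewrite subrKC.
  move=> /le_trans; apply; rewrite -ler_pdivlMr//; exact: ltW.
have [tt'|t't|<-] := ltgtP t t'.
- by rewrite distrC; exact: key.
- by rewrite distrC in h1; rewrite distrC in h2; exact: key.
- by rewrite subrr normr0 ltW.
Qed.

Lemma expect_continuous g (t : R) : bounded_measurable g -> 0 < t ->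
  u g x @[x --> t] --> u g t.
Proof.
move=> bg t0; apply/cvgrPdist_le => e e0.
have [del del0 H] := expect_near bg (ltW t0) e0.
near=> x; apply: H.
- by apply: ltW; near: x; exact: lt_nbhsr.
- by near: x; exact: (@cvgr_dist_lt _ _ _ _ _ _ _ cvg_id).
Unshelve. all: by end_near. Qed.

Lemma expect_right_continuous g : bounded_measurable g -> u g x @[x --> 0^'+] --> u g 0.
Proof.
move=> bg; apply/cvgrPdist_le => e e0.
have [del del0 H] := expect_near bg (lexx 0) e0.
near=> x; apply: H => //.
by rewrite sub0r normrN ger0_norm//; near: x; exact: nbhs_right_lt.
Unshelve. all: by end_near. Qed.

Lemma expect_is_derive g (t : R) : bounded_measurable g -> 0 < t ->
  is_derive t 1 (u g) (u (L g) t).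
Proof.
move=> bg t0.
suff H : h^-1 *: (u g (h *: 1 + t) - u g t) @[h --> 0^'] --> u (L g) t.
  by split; [apply/cvg_ex; exists (u (L g) t)|exact: cvg_lim].
apply/cvgrPdist_le => e e0.
have e2 : 0 < e / 2 by rewrite divr_gt0.
have [d1 d10 H1] := expect_increment bg e2.
have [d2 d20 H2] := expect_near (bL bg) (ltW t0) e2.
near=> h.
have hn : h != 0 by near: h; exact: nbhs_dnbhs_neq.
have hs : `|h| < Num.min (Num.min d1 d2) t.
  by near: h; apply: dnbhs0_lt; rewrite !lt_min d10 d20 t0.
move: hs; rewrite !lt_min => /andP[/andP[hd1 hd2] ht].
rewrite /GRing.scale /= mulr1.
have [h0|h0|h0] := ltgtP h 0; last by rewrite h0 eqxx in hn.
- rewrite ltr0_norm// in hd1 hd2 ht.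
  have th0 : 0 <= t + h by lra.
  have k0 : 0 < - h by lra.
  (* For h < 0 the increment estimate starts from t + h, and the continuity of
     the expectation of L g brings the derivative back to t. *)
  have := H1 _ _ th0 k0 hd1; rewrite addrK.
  have := H2 (t + h) th0; rewrite opprD addNKr normrN ltr0_norm// => /(_ hd2).
  rewrite (addrC h) => A B.
  have -> : u (L g) t - h^-1 * (u g (t + h) - u g t) =
    (u (L g) t - u (L g) (t + h))
    - (- h)^-1 * (u g t - u g (t + h) - (- h) * u (L g) (t + h)).
    by rewrite invrN; field.
  rewrite (le_trans (ler_normB _ _))// [leRHS](splitr e) lerD//.
  by rewrite normrM normfV [`|- h|]gtr0_norm// ler_pdivrMl.
- rewrite gtr0_norm// in hd1 hd2 ht.
  have := H1 t h (ltW t0) h0 hd1; rewrite (addrC h) => A.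
  have -> : u (L g) t - h^-1 * (u g (t + h) - u g t) =
    - (h^-1 * (u g (t + h) - u g t - h * u (L g) t)) by field.
  rewrite normrN normrM normfV [`|h|]gtr0_norm// ler_pdivrMl//.
  by apply: (le_trans A); rewrite ler_pM2l//; lra.
Unshelve. all: by end_near. Qed.

Hypothesis LD : forall g c z, L (fun y => g y + c) z = L g z.

(** Since d/dt E[g(Z_t)] = E[L g(Z_t)], the integrand is the derivative of
    - lam exp (- lam t) E[g(Z_t)].  Positivity is what the fundamental theorem of
    calculus on a half-line asks for. *)
Lemma laplace_expectation (lam : R) g : 0 < lam -> bounded_measurable g ->
  (forall z, 0 <= lam * g z - L g z) ->
  (\int[leb]_(t in `[0%R, +oo[)
    (lam * (expR (- (lam * t)) * u (fun z => lam * g z - L g z) t))%:E =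
   (lam * u g 0)%:E)%E.
Proof.
move=> lam0 bg k0.
pose k z := lam * g z - L g z.
have bk : bounded_measurable k.
  by apply: bounded_measurableB; [exact: bounded_measurableZ|exact: bL].
have uk t : 0 <= t -> u k t = lam * u g t - u (L g) t.
  move=> t0; rewrite /u /k -expectZ; last exact: bZ.
  rewrite -[X in _ - X]mul1r -mulNr -expectZ; last exact: bZ t0 (bL bg).
  rewrite -expectD; last 2 first.
  - by apply: bounded_measurableZ; exact: bZ.
  - by apply: bounded_measurableZ; exact: bZ t0 (bL bg).
  by congr (expect P _); apply/funext => w; rewrite mulN1r.
have cexp : continuous (fun t : R => expR (- (lam * t))).
  move=> t; apply: continuous_comp; last exact: continuous_expR.
  by apply: (@continuousN _ R^o); apply: continuousM => //; exact: cst_continuous.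
have dexp (t : R) : is_derive t 1 (fun t : R => expR (- (lam * t))) (- lam * expR (- (lam * t))).
  have d0 : is_derive t 1 ((- lam) \*: (@id R)) ((- lam) *: 1) by exact: is_deriveZ.
  rewrite (_ : (fun t => _) = expR \o ((- lam) \*: (@id R))); last first.
    by apply/funext => y /=; rewrite -mulNr.
  apply: is_derive_eq; rewrite mulrC; congr (_ * expR _); last exact: mulNr.
  by rewrite /GRing.scale/= mulr1.
pose F t := - (expR (- (lam * t)) * u g t).
have dF (t : R) : 0 < t -> is_derive t 1 F (expR (- (lam * t)) * u k t).
  move=> t0; have dg := expect_is_derive bg t0.
  apply: (is_derive_eq (is_deriveN (is_deriveM (dexp t) dg))).
  by rewrite uk ?(ltW t0)// /GRing.scale /=; ring.
have dlF (t : R) : 0 < t ->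
    is_derive t 1 (fun t => lam * F t) (lam * (expR (- (lam * t)) * u k t)).
  by move=> t0; exact: is_deriveZ (dF t t0).
rewrite (@ge0_continuous_FTC2y _ (fun t => lam * (expR (- (lam * t)) * u k t)) (fun t => lam * F t) 0 (lam * 0)).
- by rewrite /F !mulr0 oppr0 expR0 mul1r mulrN EFinN oppeK add0e.
- by move=> t t0; rewrite mulr_ge0 ?(ltW lam0)// mulr_ge0 ?expR_ge0//; apply: expect_ge0 => w; exact: k0.
- apply/continuous_within_itvcyP; split.
    move=> t; rewrite in_itv/= andbT => t0; apply: cvgMr.
    by apply: cvgM; [exact: cexp|exact: expect_continuous].
  apply: cvgMr; apply: cvgM; last exact: expect_right_continuous.
  exact: (cvg_at_right_filter (cexp 0)).
- apply: cvgMr; have [_ [M gM]] := bg.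
  have h : expR (- (lam * t)) * M @[t --> +oo] --> 0 * M.
    apply: cvgMl; apply: (@cvg_comp _ _ _ (fun t => lam * t) (fun t => expR (- t)) _ (pinfty_nbhs R)); last exact: cvgr_expR.
    exact: gt0_cvgMry.
  rewrite mul0r in h; apply/cvgrPdist_le => e e0.
  near=> t.
  have t0 : 0 <= t by near: t; exact: nbhs_pinfty_ge.
  rewrite sub0r /F opprK normrM; apply: (@le_trans _ _ `|0 - expR (- (lam * t)) * M|).
    rewrite sub0r normrN normrM ler_wpM2l// (le_trans _ (ler_norm _))//.
    by apply: expect_norm_le; first exact: bZ.
  by near: t; exact: (@cvgr_dist_le _ _ _ _ _ _ _ h).
- by move=> t /dlF[].
- apply: cvgMr; apply: cvgN; apply: cvgM; last exact: expect_right_continuous.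
  exact: (cvg_at_right_filter (cexp 0)).
- move=> t; rewrite in_itv/= andbT => t0.
  by rewrite derive1E; case: (dlF t t0).
Unshelve. all: by end_near. Qed.

(** Adding a large constant to g makes lam g - L g nonnegative and changes both sides
    by the same amount. *)
Lemma resolvent_identity (lam : R) : 0 < lam -> exists nu : probability S R,
  (forall f : S -> R, measurable_fun setT f -> (forall z, 0 <= f z) ->
    (\int[nu]_z (f z)%:E =
     \int[leb]_(t in `[0%R, +oo[)
       ((\int[P]_w (f (Z t w))%:E) * (lam * expR (- (lam * t)))%:E))%E) /\
  (forall g, bounded_measurable g ->
    expect nu (fun z => lam * g z - L g z) = lam * expect P (fun w => g (Z 0 w))).
Proof.
move=> lam0; have [nu nuE] := occupation_law mZ pZ P lam0.
exists nu; split => // g bg.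
have bk (f : S -> R) : bounded_measurable f -> bounded_measurable (fun z => lam * f z - L f z).
  by move=> bf; apply: bounded_measurableB; [exact: bounded_measurableZ|exact: bL].
have pos (f : S -> R) : bounded_measurable f -> (forall z, 0 <= lam * f z - L f z) ->
    expect nu (fun z => lam * f z - L f z) = lam * u f 0.
  move=> bf k0; rewrite /expect /Rintegral nuE//; last by case: (bk f bf).
  rewrite -[RHS]/(fine (lam * u f 0)%:E) -(laplace_expectation lam0 bf k0); congr fine.
  apply: eq_integral => t; rewrite inE/= in_itv/= andbT => t0.
  rewrite -[X in (X * _)%E]fineK; last first.
    apply: integrable_fin_num => //.
    exact: (bounded_measurable_integrable P (bZ t0 (bk f bf))).
  rewrite -EFinM; congr EFin; rewrite -[fine _]/(u (fun z => lam * f z - L f z) t).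
  by rewrite mulrC mulrA.
have [_ [M kM]] := bk g bg.
have M0 : 0 <= `|M| := normr_ge0 M.
(* lam c = |M| makes lam (g + c) - L (g + c) nonnegative, as L kills constants. *)
pose c := `|M| / lam.
have cM : lam * c = `|M| by rewrite /c mulrC divfK// gt_eqF.
have bc : bounded_measurable (fun z => g z + c).
  by apply: bounded_measurableD => //; exact: bounded_measurable_cst.
have := pos _ bc.
have -> : (fun z => lam * (g z + c) - L (fun y => g y + c) z) = (fun z => (lam * g z - L g z) + `|M|).
  by apply/funext => z; rewrite LD mulrDr cM addrAC.
rewrite expectD ?expect_cst//; [|exact: bk|exact: bounded_measurable_cst].
rewrite /u expectD ?expect_cst//; [|exact: bZ|exact: bounded_measurable_cst].
rewrite mulrDr cM => h; apply: (addIr `|M|); apply: h => z.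
by rewrite LD mulrDr cM; have := kM z; have := ler_norm M; rewrite ler_norml => ? /andP[]; lra.
Qed.

End resolvent_identity.

(** * The walk and its position *)

Section walk_space.
Context {R : realType}.
Implicit Types (z : config * int).

Lemma measurable_int_fun {d} {T : measurableType d} (g : int -> T) : measurable_fun setT g.
Proof. by []. Qed.

Lemma measurable_position (g : int -> R) : measurable_fun setT (fun z : config * int => g z.2).
Proof. by apply: (measurableT_comp (f := g)) => //; exact: measurable_int_fun. Qed.

Lemma measurable_environment (f : config -> R) : measurable_fun setT f ->
  measurable_fun setT (fun z : config * int => f z.1).
Proof. by move=> mf; exact: measurableT_comp. Qed.

Lemma measurable_walk_swap : measurable_fun setT walk_swap.
Proof.
apply/measurable_fun_pairP; split => /=; last exact: measurable_snd.
exact: (measurableT_comp measurable_swap measurable_fst).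
Qed.

Lemma measurable_walk_step e : measurable_fun setT (walk_step e).
Proof.
apply/measurable_fun_pairP; split => /=.
  exact: (measurableT_comp (measurable_step e) measurable_fst).
apply: (measurableT_comp (f := fun x : int => x + arrow e)) => //; exact: measurable_int_fun.
Qed.

Lemma measurable_walk_hand_step : measurable_fun setT walk_hand_step.
Proof.
apply/measurable_fun_pairP; split => /=.
  exact: (measurableT_comp (measurable_hand_shift true) measurable_fst).
rewrite (_ : _ \o _ = (fun z : config * int => if z.1 None then z.2 + 1 else z.2 - 1)).
  apply: measurable_fun_ifT.
  - exact: (measurableT_comp (measurable_eval None) measurable_fst).
  - by apply: (measurableT_comp (f := fun x : int => x + 1)) => //; exact: measurable_int_fun.
  - by apply: (measurableT_comp (f := fun x : int => x - 1)) => //; exact: measurable_int_fun.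
by apply/funext => z /=; rewrite /arrow; case: (z.1 None).
Qed.

Local Notation walk_reach := (reach walk_swap walk_step walk_hand_step).

Lemma walk_reach_position z z' : walk_reach z z' ->
  (`|z'.2| <= `|z.2|.+1)%N /\ (`|z.2| <= `|z'.2|.+1)%N.
Proof.
case=> z0 [z1 [h0 h1 h2]].
have E0 : z0.2 = z.2 by case: h0 => ->.
have E2 : z'.2 = z1.2 by case: h2 => ->.
have [b ->] : exists b, z'.2 = z.2 + arrow b.
  by rewrite E2 -E0; case: h1 => [->|[e ->]]; [exists (z0.1 None)|exists e].
by case: b; rewrite /arrow; lia.
Qed.

Variables (m : model) (eps : R).
Local Notation L := (walk_generator m eps).
Local Notation G := (env_generator m eps).

Lemma measurable_walk_generator (g : config * int -> R) :
  measurable_fun setT g -> measurable_fun setT (L g).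
Proof.
by apply: measurable_generator => //; [exact: measurable_walk_swap |
  exact: measurable_walk_step | exact: measurable_walk_hand_step].
Qed.

Definition position z : R := z.2%:~R.

Definition drift (w : config) : R :=
  match m with M1 => sgn (w None) | M2 => 2^-1 * (sgn (w None) + sgn (w (Some 0))) end.

(** The rate at which the walker moves times the value of f after the jump: the cross
    term in the action of the generator on a product of the position with f. *)
Definition flux (f : config -> R) (w : config) : R :=
  L (fun z => position z * f z.1) (w, 0).

(** The position changes by +1 or -1 at total rate 1 + eps; the environment steps displace the
    walker by 0 on average. *)
Lemma walk_generator_sqr z :
  L (fun y => position y ^+ 2) z = 2 * position z * drift z.1 + (1 + eps).
Proof.
case: z => w x; rewrite /walk_generator /generator /opU big_bool /drift /position.
have sg b : (arrow b)%:~R = sgn b :> R by rewrite sgnE.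
rewrite /opTtilde /opT /walk_step /walk_swap /walk_hand_step /= !intrD !sg.
have s2 b : sgn b ^+ 2 = 1 :> R by rewrite expr2 sgn2.
rewrite rmorphN1 rmorph1; move: (x%:~R) => r.
case: m => /=.
- move: (sgn _) (s2 (w None)) => a a2.
  by transitivity (2 * r * a + a ^+ 2 + eps); [field|rewrite a2; ring].
- rewrite -[swap w None]/(w (Some 0)); move: (sgn (w None)) (sgn (w (Some 0))) (s2 (w None)) (s2 (w (Some 0))) => a b a2 b2.
  by transitivity (r * (a + b) + 2^-1 * (a ^+ 2 + b ^+ 2) + eps); [field|rewrite a2 b2; field].
Qed.

Lemma walk_generator_product (f : config -> R) z :
  L (fun y => position y * f y.1) z = position z * G f z.1 + flux f z.1.
Proof.
case: z => w x; rewrite /flux /walk_generator /env_generator /generator /opU !big_bool /position.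
rewrite /opTtilde /walk_step /walk_swap /walk_hand_step /= !intrD.
case: m; rewrite /opT /= ?intrD; ring.
Qed.

Hypothesis eps_ge0 : 0 <= eps.

Lemma bounded_walk_generator (g : config * int -> R) :
  bounded_measurable g -> bounded_measurable (L g).
Proof.
by apply: bounded_measurable_generator => //; [exact: measurable_walk_swap |
  exact: measurable_walk_step | exact: measurable_walk_hand_step].
Qed.

Lemma bounded_env_generator (f : config -> R) :
  bounded_measurable f -> bounded_measurable (G f).
Proof.
by apply: bounded_measurable_generator => //; [exact: measurable_swap |
  exact: measurable_step | exact: (measurable_hand_shift true)].
Qed.

Lemma env_resolvent (lam : R) (F : bdm_fun R config) : 0 < lam ->
  exists psi : bdm_fun R config, forall w, lam * psi w - G psi w = F w.
Proof.
move=> lam0.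
have [|||psi bpsi psiE] := resolvent_exists (sw := swap) (st := step) (hst := hand_step)
  _ _ _ m eps_ge0 lam0 (bdm_funP F).
- exact: measurable_swap.
- exact: measurable_step.
- exact: (measurable_hand_shift true).
by exists (bdm_of bpsi).
Qed.

End walk_space.

(** * Functions of quadratic growth *)

Section stationary_walk.
Context {R : realType}.
Variables (m : model) (eps : R).
Hypothesis eps_ge0 : 0 <= eps.
Local Notation L := (walk_generator m eps).
Local Notation G := (env_generator m eps).
Variables (mu : probability config R) (hmu : iid_uniform mu id).
Variables (lam : R) (lam_gt0 : 0 < lam) (nu : probability (config * int)%type R).
Hypothesis nuE : forall g, bounded_measurable g ->
  expect nu (fun z => lam * g z - L g z) = lam * expect mu (fun w => g (w, 0)).

Lemma bounded_measurable_fst (f : config -> R) : bounded_measurable f ->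
  bounded_measurable (fun z : config * int => f z.1).
Proof. by move=> [mf [M fM]]; split; [exact: measurable_environment|exists M]. Qed.

Lemma expect_opTtilde tau (f : config -> R) :
  (forall g : config -> R, bounded_measurable g -> bounded_measurable (fun w => g (tau w))) ->
  (forall g : config -> R, bounded_measurable g -> expect mu (fun w => g (tau w)) = expect mu g) ->
  bounded_measurable f -> expect mu (opTtilde swap tau f) = 0.
Proof.
move=> btau htau bf.
have bs (g : config -> R) : bounded_measurable g -> bounded_measurable (fun w => g (swap w)).
  by move=> bg; exact: bounded_measurable_comp measurable_swap bg.
have hs := expect_swap hmu.
have b1 := btau _ bf; have b2 := btau _ (bs _ bf).
have b3 := bs _ b1; have b4 := bs _ b2.
rewrite /opTtilde.
under [X in expect mu X]eq_fun do rewrite -mulN1r.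
rewrite !expectD ?expectZ//; do ?[apply: bounded_measurableD|apply: bounded_measurableZ] => //.
rewrite (hs _ b1) (hs _ b2) (htau _ (bs _ bf)) (htau _ bf) (hs _ bf); lra.
Qed.

Lemma expect_env_generator (f : config -> R) : bounded_measurable f ->
  expect mu (G f) = 0.
Proof.
move=> bf.
have bh (g : config -> R) : bounded_measurable g -> bounded_measurable (fun w => g (hand_step w)).
  by move=> bg; exact: bounded_measurable_comp (measurable_hand_shift true) bg.
have hh (g : config -> R) : bounded_measurable g -> expect mu (fun w => g (hand_step w)) = expect mu g.
  exact: (expect_hand_shift hmu true).
have bs (e : bool) (g : config -> R) : bounded_measurable g -> bounded_measurable (fun w => g (step e w)).
  by move=> bg; exact: bounded_measurable_comp (measurable_step e) bg.
have bw : bounded_measurable (fun w => f (swap w)).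
  exact: bounded_measurable_comp measurable_swap bf.
have bT tau : (forall g : config -> R, bounded_measurable g -> bounded_measurable (fun w => g (tau w))) ->
    bounded_measurable (opTtilde swap tau f).
  move=> btau.
  have c (g : config -> R) : bounded_measurable g -> bounded_measurable (fun w => g (swap w)).
    by move=> bg; exact: bounded_measurable_comp measurable_swap bg.
  have b1 := btau _ bf; have b2 := btau _ bw; have b3 := c _ b1; have b4 := c _ b2.
  apply: bounded_measurableB => //.
  by do ?[apply: bounded_measurableD|apply: bounded_measurableZ].
have T e := expect_opTtilde (bs e) (fun g => expect_step hmu e (f := g)) bf.
rewrite /env_generator /generator /opU.
have -> : (fun z => match m with | M1 => opT swap hand_step f z | M2 => opTtilde swap hand_step f z end
      + eps * (2^-1 * \sum_(e : bool) opTtilde swap (step e) f z)) =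
   (fun z => match m with | M1 => opT swap hand_step f z | M2 => opTtilde swap hand_step f z end
      + eps * (2^-1 * (opTtilde swap (step true) f z + opTtilde swap (step false) f z))).
  by apply/funext => z; rewrite big_bool.
rewrite expectD; last 2 first.
- case: m; last exact: (bT _ bh).
  by apply: bounded_measurableB => //; exact: (bh _ bw).
- by do 2 apply: bounded_measurableZ; apply: bounded_measurableD; exact: (bT _ (bs _)).
rewrite expectZ; last by apply: bounded_measurableZ; apply: bounded_measurableD; exact: (bT _ (bs _)).
rewrite expectZ; last by apply: bounded_measurableD; exact: (bT _ (bs _)).
rewrite expectD ?T; [|exact: (bT _ (bs _))|exact: (bT _ (bs _))].
rewrite addr0 !mulr0 addr0.
case: m; last exact: (expect_opTtilde bh hh bf).
rewrite /opT; under [X in expect mu X]eq_fun do rewrite -mulN1r.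
rewrite expectD; [|exact: (bh _ bw)|exact: bounded_measurableZ].
by rewrite expectZ// (hh _ bw) (expect_swap hmu bf) mulN1r subrr.
Qed.

(** The function f is lam b - G b for a bounded b, and both sides integrate such
    functions to lam times the mean of b. *)
Lemma stationary (f : config -> R) : bounded_measurable f ->
  expect nu (fun z => f z.1) = expect mu f.
Proof.
move=> bf; have [b bE] := env_resolvent m eps_ge0 (bdm_of bf) lam_gt0.
have bb := bdm_funP b; have bG := bounded_env_generator m eps_ge0 bb.
have := nuE (bounded_measurable_fst bb).
have -> : (fun z : config * int => lam * b z.1 - L (fun y => b y.1) z) = (fun z => f z.1).
  by apply/funext => z; rewrite walk_generator_fst bE.
move=> ->; rewrite (_ : f = (fun w => lam * b w + (- 1) * G b w)); last first.
  by apply/funext => w; rewrite mulN1r bE.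
rewrite expectD ?expectZ// ?expect_env_generator ?mulr0 ?addr0//; exact: bounded_measurableZ.
Qed.

Definition clip (n : nat) (z : config * int) : R := (minn `|z.2| n)%:R.

(** The constant left over when (1 + eps) (2 c + 1) is bounded by lam c^2 / 2. *)
Definition moment_bound : R := (1 + eps) * (1 + 2 * (1 + eps) / lam).

(** One jump changes the square of the clipped position by at most a linear amount,
    which is absorbed in lam / 2 times the square.  The bound does not depend on
    the level of the clipping. *)
Lemma clipped_moment n : expect nu (fun z => clip n z ^+ 2) <= 2 * moment_bound / lam.
Proof.
have bw : bounded_measurable (fun z => clip n z ^+ 2).
  split; first exact: (measurable_position (fun x => (minn `|x| n)%:R ^+ 2)).
  exists (n%:R ^+ 2) => z; rewrite normrX lerXn2r ?nnegrE// /clip normr_nat ler_nat.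
  exact: geq_minr.
have b1 : bounded_measurable (fun z => lam * clip n z ^+ 2 - L (fun y => clip n y ^+ 2) z).
  apply: bounded_measurableB; first exact: bounded_measurableZ.
  exact: (bounded_walk_generator m eps_ge0 bw).
have h : expect nu (fun z => lam / 2 * clip n z ^+ 2 + - moment_bound) <=
    expect nu (fun z => lam * clip n z ^+ 2 - L (fun y => clip n y ^+ 2) z).
  apply: expect_le => // [|z].
    by apply: bounded_measurableD; [exact: bounded_measurableZ|exact: bounded_measurable_cst].
  (* The clipped position moves by at most 1 in one jump. *)
  have : `|L (fun y => clip n y ^+ 2) z| <= (1 + eps) * (2 * clip n z + 1).
    apply: generator_increment_bound => // z' hz; have [d1 d2] := walk_reach_position hz.
    have c1 : clip n z' <= clip n z + 1 by rewrite /clip natr1 ler_nat; lia.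
    have c2 : clip n z <= clip n z' + 1 by rewrite /clip natr1 ler_nat; lia.
    have c0 : 0 <= clip n z by rewrite ler0n.
    have c0' : 0 <= clip n z' by rewrite ler0n.
    move: (clip n z') (clip n z) c1 c2 c0 c0' => c' c c1 c2 c0 c0'.
    have p1 : 0 <= (c + 1 - c') * (c + 1 + c') by rewrite mulr_ge0//; lra.
    have p2 : 0 <= (c' + 1 - c) * (c' + c) by rewrite mulr_ge0//; lra.
    rewrite ler_norml; apply/andP; split; last by lra.
    have [cc|cc] := leP c c'; last by lra.
    have p3 : 0 <= (c' - c) * (c' + c) by rewrite mulr_ge0//; lra.
    by lra.
  rewrite ler_norml => /andP[_ hL].
  have k0 : 0 < 1 + eps by rewrite ltr_wpDr.
  move: (clip n z) hL => c hL.
  have : (1 + eps) * (2 * c) <= lam / 2 * c ^+ 2 + (1 + eps) * (2 * (1 + eps) / lam).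
    have l2 : 0 < 2 / lam by rewrite divr_gt0.
    have := mulr_ge0 (ltW l2) (sqr_ge0 (lam / 2 * c - (1 + eps))).
    have -> : 2 / lam * (lam / 2 * c - (1 + eps)) ^+ 2 = lam / 2 * c ^+ 2 - (1 + eps) * (2 * c)
       + (1 + eps) * (2 * (1 + eps) / lam) by field; rewrite gt_eqF.
    lra.
  rewrite /moment_bound; lra.
move: h; rewrite (nuE bw) /clip /= min0n expr0n expect_cst mulr0.
rewrite expectD ?expect_cst//; [|exact: bounded_measurableZ|exact: bounded_measurable_cst].
rewrite expectZ// => h.
rewrite ler_pdivlMr//; move: h; rewrite /clip; lra.
Qed.

Lemma second_moment : (\int[nu]_z (position z ^+ 2)%:E <= (2 * moment_bound / lam)%:E)%E.
Proof.
have mw n : measurable_fun setT (fun z => clip n z ^+ 2).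
  exact: (measurable_position (fun x => (minn `|x| n)%:R ^+ 2)).
have bw n : bounded_measurable (fun z => clip n z ^+ 2).
  split => //; exists (n%:R ^+ 2) => z; rewrite normrX lerXn2r ?nnegrE// /clip normr_nat ler_nat.
  exact: geq_minr.
have lim z : (clip n z ^+ 2)%:E @[n --> \oo] --> (position z ^+ 2)%:E.
  apply: cvg_near_cst; exists `|z.2|%N => // n /= zn.
  by rewrite /clip (minn_idPl zn) /position pmulrn abszE intr_norm real_normK ?num_real.
have H := @cvg_monotone_convergence _ _ _ nu setT measurableT (fun n z => (clip n z ^+ 2)%:E).
have {}H : (\int[nu]_z (clip n z ^+ 2)%:E)%E @[n --> \oo] --> (\int[nu]_z (position z ^+ 2)%:E)%E.
  rewrite (_ : (fun z => (position z ^+ 2)%:E) = (fun z => limn (fun n => (clip n z ^+ 2)%:E))).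
    apply: H.
    - by move=> n; exact/measurable_EFinP.
    - by move=> n z _; rewrite lee_fin sqr_ge0.
    - move=> z _ a b ab; rewrite lee_fin lerXn2r ?nnegrE ?ler0n//.
      by rewrite /clip ler_nat; lia.
  by apply/funext => z; apply/esym/cvg_lim => //; exact: lim.
apply: (cvge_to_le H); apply: nearW => n.
rewrite -[X in (X <= _)%E]fineK ?lee_fin; first exact: clipped_moment.
by apply: integrable_fin_num => //; exact: bounded_measurable_integrable (bw n).
Qed.

Lemma integrable_quadratic (K : R) :
  nu.-integrable setT (EFin \o (fun z => K * (1 + position z ^+ 2))).
Proof.
have mp : measurable_fun setT (fun z : config * int => position z ^+ 2 : R).
  exact: (measurable_position (fun x : int => x%:~R ^+ 2 : R)).
have ip : nu.-integrable setT (EFin \o (fun z => position z ^+ 2)).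
  apply/integrableP; split; first exact/measurable_EFinP.
  under eq_integral do rewrite /= ger0_norm ?sqr_ge0//.
  by rewrite (le_lt_trans second_moment)// ltry.
pose q z : R := position z ^+ 2.
suff : nu.-integrable setT (EFin \o (fun z => 1 + q z)) by exact: integrableZl.
pose f1 : config * int -> \bar R := EFin \o cst 1.
pose f2 : config * int -> \bar R := EFin \o q.
suff : nu.-integrable setT (fun z => f1 z + f2 z)%E by [].
apply: integrableD => //.
exact: (bounded_measurable_integrable nu (bounded_measurable_cst 1)).
Qed.

(** Functions of quadratic growth are limits of their truncations to bounded
    positions.  As one jump moves the position by at most 1, the generator keeps
    the quadratic bound and dominated convergence applies. *)
Lemma resolvent_identity_quadratic (g : config * int -> R) (C : R) :
  measurable_fun setT g -> (forall z, `|g z| <= C * (1 + position z ^+ 2)) ->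
  expect nu (fun z => lam * g z - L g z) = lam * expect mu (fun w => g (w, 0)).
Proof.
move=> mg gC.
have C0 : 0 <= C.
  have := le_trans (normr_ge0 _) (gC (point, 0)).
  by rewrite /position /= expr0n /= addr0 mulr1.
pose gn n (z : config * int) := g z * (`|z.2| <= n)%N%:R.
have mgn n : measurable_fun setT (gn n).
  apply: measurable_funM => //.
  exact: (measurable_position (fun x : int => (`|x| <= n)%N%:R : R)).
have bgn n : bounded_measurable (gn n).
  split => //; exists (C * (1 + n%:R ^+ 2)) => z; rewrite /gn.
  have [zn|zn] := leqP `|z.2|%N n; last first.
    by rewrite mulr0 normr0 mulr_ge0// addr_ge0// sqr_ge0.
  rewrite mulr1 (le_trans (gC z))// ler_wpM2l// lerD2l /position.
  rewrite -[leLHS]real_normK ?num_real// -intr_norm -abszE -pmulrn lerXn2r ?nnegrE//.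
  by rewrite ler_nat.
have gnC n z : `|gn n z| <= C * (1 + position z ^+ 2).
  apply: le_trans (gC z); rewrite /gn normrM.
  by case: (_ <= _)%N; rewrite ?normr1 ?mulr1// normr0 mulr0.
pose K := (lam + 4 * (1 + eps)) * C.
have e1 : 0 <= 1 + eps by rewrite addr_ge0.
have LC n z : `|lam * gn n z - L (gn n) z| <= K * (1 + position z ^+ 2).
  have hL : `|L (gn n) z + (1 + eps) * gn n z| <= (1 + eps) * (C * (3 * (1 + position z ^+ 2))).
    apply: generator_bound => // z' hz; apply: (le_trans (gnC n z')).
    rewrite ler_wpM2l//; have [d1 _] := walk_reach_position hz.
    have : `|position z'| <= `|position z| + 1 :> R.
      by rewrite /position -!intr_norm -!abszE -!pmulrn natr1 ler_nat.
    rewrite -[X in _ + X <= _]real_normK ?num_real// -[X in _ <= _ * (_ + X)]real_normK ?num_real//.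
    move: (normr_ge0 (@position R z')) (normr_ge0 (@position R z)).
    move: `|@position R z'| `|@position R z| => a b a0 b0 ab.
    have p1 : 0 <= (b + 1 - a) * (b + 1 + a) by rewrite mulr_ge0//; lra.
    by have := sqr_ge0 (b - 1); have := sqr_ge0 b; lra.
  have -> : lam * gn n z - L (gn n) z = (lam + (1 + eps)) * gn n z
      - (L (gn n) z + (1 + eps) * gn n z) by ring.
  apply: (le_trans (ler_normB _ _)); rewrite normrM ger0_norm; last by rewrite addr_ge0// ltW.
  have h2 := ler_wpM2l (addr_ge0 (ltW lam_gt0) e1) (gnC n z).
  have -> : K * (1 + position z ^+ 2) = (lam + (1 + eps)) * (C * (1 + position z ^+ 2))
      + (1 + eps) * (C * (3 * (1 + position z ^+ 2))) by rewrite /K; ring.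
  exact: lerD.
have cv z : lam * gn n z - L (gn n) z @[n --> \oo] --> lam * g z - L g z.
  apply: cvg_near_cst; exists `|z.2|.+1 => // n /= zn.
  have E z' : (`|z'.2| <= `|z.2|.+1)%N -> gn n z' = g z'.
    by move=> h; rewrite /gn (leq_trans h zn) mulr1.
  rewrite E//; congr (_ - _); apply: generator_local => // [|z' hz]; first exact: E.
  by apply: E; case: (walk_reach_position hz).
have DC := @dominated_convergence _ _ _ nu setT measurableT
  (fun n z => (lam * gn n z - L (gn n) z)%:E) (fun z => (lam * g z - L g z)%:E)
  (fun z => (K * (1 + position z ^+ 2))%:E).
have {DC}[||||| _ _ DC] := DC.
- move=> n; apply/measurable_EFinP; apply: measurable_funB; first exact: measurable_funM.
  exact: measurable_walk_generator.
- apply/measurable_EFinP; apply: measurable_funB; first exact: measurable_funM.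
  exact: measurable_walk_generator.
- by apply: aeW => z _; apply: cvg_EFin; [exact: nearW|exact: cv].
- exact: integrable_quadratic.
- by apply: aeW => z n _; rewrite lee_fin.
have cst : (fun n => \int[nu]_z (lam * gn n z - L (gn n) z)%:E)%E =
    (fun n => (lam * expect mu (fun w => g (w, 0)))%:E).
  apply/funext => n; rewrite -[LHS]fineK; last first.
    apply: integrable_fin_num => //; apply: bounded_measurable_integrable.
    apply: bounded_measurableB; first exact: bounded_measurableZ.
    exact: bounded_walk_generator.
  rewrite -[fine _]/(expect nu _) nuE//; congr (lam * expect mu _)%:E.
  by apply/funext => w; rewrite /gn /= mulr1.
rewrite cst in DC.
have := cvg_unique _ DC (cvg_cst _).
by rewrite /expect /Rintegral => ->.
Qed.

End stationary_walk.

(** * The second moment at an exponential time *)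

Section second_moment_formula.
Context {R : realType}.
Variables (m : model) (eps : R).
Hypothesis eps_ge0 : 0 <= eps.
Local Notation L := (walk_generator m eps).
Local Notation G := (env_generator m eps).
Variables (mu : probability config R) (hmu : iid_uniform mu id).

(** The drift of the time-reversed walk. *)
Definition backward_drift (w : config) : R :=
  match m with M1 => sgn (w (Some 0)) | M2 => 2^-1 * (sgn (w None) + sgn (w (Some 0))) end.

(** The contribution of the hand step to the flux. *)
Definition jump_flux (f : config -> R) (w : config) : R :=
  match m with
  | M1 => sgn (w None) * f (swap (hand_step w))
  | M2 => 4^-1 * (sgn (w None) * f (hand_step w) + sgn (w None) * f (swap (hand_step w))
      + sgn (w (Some 0)) * f (hand_step (swap w)) + sgn (w (Some 0)) * f (swap (hand_step (swap w))))
  end.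

Definition lazy_step (f : config -> R) (e : bool) (w : config) : R :=
  4^-1 * (f (step e w) + f (swap (step e w)) + f (step e (swap w)) + f (swap (step e (swap w)))).

Lemma fluxE f w : flux m eps f w =
  jump_flux f w + eps / 2 * (lazy_step f true w - lazy_step f false w).
Proof.
rewrite /flux /walk_generator /generator /opU big_bool /position /opTtilde /jump_flux /lazy_step.
rewrite /walk_step /walk_swap /walk_hand_step /opT /= !intrD.
have sg b : (arrow b)%:~R = sgn b :> R by rewrite sgnE.
rewrite !sg rmorphN1 rmorph1.
by case: m => /=; rewrite -?[swap w None]/(w (Some 0)); field.
Qed.

Let bsw (g : config -> R) : bounded_measurable g -> bounded_measurable (fun w => g (swap w)).
Proof. by move=> bg; exact: bounded_measurable_comp measurable_swap bg. Qed.

Let bst e (g : config -> R) : bounded_measurable g -> bounded_measurable (fun w => g (step e w)).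
Proof. by move=> bg; exact: bounded_measurable_comp (measurable_step e) bg. Qed.

Let bhs (g : config -> R) : bounded_measurable g -> bounded_measurable (fun w => g (hand_step w)).
Proof. by move=> bg; exact: bounded_measurable_comp (measurable_hand_shift true) bg. Qed.

Let ehs (g : config -> R) : bounded_measurable g ->
  expect mu (fun w => g (hand_step w)) = expect mu g.
Proof. exact: (expect_hand_shift hmu true). Qed.

Let bsgn (x : option int) (g : config -> R) : bounded_measurable g ->
  bounded_measurable (fun w : config => sgn (w x) * g w).
Proof. by move=> bg; apply: bounded_measurableM bg; exact: bounded_measurable_bool. Qed.

Lemma bounded_lazy_step f e : bounded_measurable f -> bounded_measurable (lazy_step f e).
Proof.
move=> bf; apply: bounded_measurableZ; have b1 := bst e bf; have b2 := bst e (bsw bf).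
have b3 := bsw b1; have b4 := bsw b2.
by do ?apply: bounded_measurableD.
Qed.

Lemma expect_lazy_step f e : bounded_measurable f -> expect mu (lazy_step f e) = expect mu f.
Proof.
move=> bf; have b1 := bst e bf; have b2 := bst e (bsw bf).
have b3 := bsw b1; have b4 := bsw b2.
rewrite /lazy_step expectZ; last by do ?apply: bounded_measurableD.
rewrite !expectD//; do ?by do ?apply: bounded_measurableD.
rewrite (expect_swap hmu b1) (expect_swap hmu b2) (expect_step hmu e (bsw bf)).
by rewrite (expect_step hmu e bf) (expect_swap hmu bf); field.
Qed.


Lemma bounded_jump_flux f : bounded_measurable f -> bounded_measurable (jump_flux f).
Proof.
move=> bf; rewrite /jump_flux; have b1 := bhs bf; have b2 := bhs (bsw bf).
have c1 := bsgn None b1; have c2 := bsgn None b2.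
have d1 := bsw c1; have d2 := bsw c2.
by case: m => //; apply: bounded_measurableZ; do ?apply: bounded_measurableD.
Qed.

Lemma expect_jump_flux f : bounded_measurable f ->
  expect mu (jump_flux f) = expect mu (fun w => backward_drift w * f w).
Proof.
move=> bf; rewrite /jump_flux /backward_drift; have b1 := bhs bf; have b2 := bhs (bsw bf).
have c1 := bsgn None b1; have c2 := bsgn None b2.
have d1 := bsw c1; have d2 := bsw c2.
have e1 : expect mu (fun w => sgn (w None) * f (hand_step w)) = expect mu (fun w => sgn (w None) * f w).
  exact: (ehs (bsgn None bf)).
have e2 : expect mu (fun w => sgn (w None) * f (swap (hand_step w))) = expect mu (fun w => sgn (w (Some 0)) * f w).
  rewrite (ehs (bsgn None (bsw bf))) -(expect_swap hmu (bsgn None (bsw bf))).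
  by congr (expect mu _); apply/funext => w; rewrite swapK.
have e3 : expect mu (fun w => sgn (w (Some 0)) * f (hand_step (swap w))) = expect mu (fun w => sgn (w None) * f w).
  by rewrite -e1; exact: (expect_swap hmu c1).
have e4 : expect mu (fun w => sgn (w (Some 0)) * f (swap (hand_step (swap w)))) = expect mu (fun w => sgn (w (Some 0)) * f w).
  by rewrite -e2; exact: (expect_swap hmu c2).
case: m; first exact: e2.
rewrite expectZ; last by do ?apply: bounded_measurableD.
rewrite !expectD//; do ?by do ?apply: bounded_measurableD.
rewrite e1 e2 e3 e4.
under [X in _ = expect mu X]eq_fun do rewrite -mulrA mulrDl.
rewrite expectZ ?expectD//; first by field.
all: by do ?apply: bounded_measurableD; exact: bsgn.
Qed.

Lemma bounded_flux f : bounded_measurable f -> bounded_measurable (flux m eps f).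
Proof.
move=> bf; rewrite (funext (fluxE f)); apply: bounded_measurableD; first exact: bounded_jump_flux.
by apply/bounded_measurableZ/bounded_measurableB; exact: bounded_lazy_step.
Qed.

(** A change of variables by the measure-preserving jump moves it from psi to the
    arrow that is followed; the contributions of the two environment steps
    cancel. *)
Lemma expect_flux f : bounded_measurable f ->
  expect mu (flux m eps f) = expect mu (fun w => backward_drift w * f w).
Proof.
move=> bf; rewrite (funext (fluxE f)); have bl e := bounded_lazy_step e bf.
rewrite expectD; last 2 first.
- exact: bounded_jump_flux.
- by apply/bounded_measurableZ/bounded_measurableB.
rewrite expectZ; last exact: bounded_measurableB.
under [X in _ + _ * expect mu X]eq_fun do rewrite -mulN1r.
rewrite (expectD _ (bl true)); last exact: bounded_measurableZ.
rewrite (expectZ _ _ (bl false)) (expect_lazy_step true bf) (expect_lazy_step false bf).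
by rewrite expect_jump_flux// mulN1r subrr mulr0 addr0.
Qed.

Variables (lam : R) (lam_gt0 : 0 < lam) (nu : probability (config * int)%type R).
Hypothesis nuE : forall g, bounded_measurable g ->
  expect nu (fun z => lam * g z - L g z) = lam * expect mu (fun w => g (w, 0)).

(** In lam g - L g for g = x^2 + 2 x psi the terms linear in x are 2 x times
    lam psi - G psi - drift = 0, and g vanishes at the starting position. *)
Lemma second_moment_formula (psi : config -> R) : bounded_measurable psi ->
  (forall w, lam * psi w - G psi w = drift m w) ->
  (lam%:E * \int[nu]_z (position z ^+ 2)%:E =
    (1 + eps + 2 * expect mu (fun w => backward_drift w * psi w))%:E)%E.
Proof.
move=> bpsi psiE.
pose q (z : config * int) : R := position z ^+ 2.
have mp : measurable_fun setT (fun z : config * int => position z : R).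
  exact: (measurable_position (fun x : int => x%:~R : R)).
have mq : measurable_fun setT q by exact: (measurable_position (fun x : int => x%:~R ^+ 2 : R)).
have iq : nu.-integrable setT (EFin \o q).
  have -> : EFin \o q = EFin \o (fun z => 1 * (1 + q z) - 1).
    by apply/funext => z /=; rewrite mul1r addrC addKr.
  pose f1 := EFin \o (fun z => 1 * (1 + q z)).
  pose f2 : config * int -> \bar R := EFin \o cst (- 1).
  suff : nu.-integrable setT (fun z => f1 z + f2 z)%E by [].
  apply: integrableD => //; first exact: (integrable_quadratic eps_ge0 lam_gt0 nuE 1).
  exact: (bounded_measurable_integrable nu (bounded_measurable_cst _)).
have [mpsi [M psiM]] := bpsi.
have M0 : 0 <= M := le_trans (normr_ge0 _) (psiM point).
pose g z := q z + 2 * (position z * psi z.1).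
have gC z : `|g z| <= (1 + 2 * M) * (1 + position z ^+ 2).
  rewrite /g (le_trans (ler_normD _ _))// /q normrX 2!normrM (ger0_norm (ler0n R 2)).
  have h : `|position z| * `|psi z.1| <= `|position z| * M by rewrite ler_wpM2l.
  rewrite -[position z ^+ 2]real_normK ?num_real//.
  move: (`|position z|) (`|psi _|) h (normr_ge0 (@position R z)) => a b h a0.
  have h2 := mulr_ge0 M0 (sqr_ge0 (a - 1)).
  have h3 := mulr_ge0 M0 (sqr_ge0 a).
  have : a * M *+ 2 <= M * (1 + a ^+ 2) by move: h2; rewrite sqrrB; lra.
  lra.
have mg : measurable_fun setT g.
  apply: measurable_funD => //; apply: measurable_funM => //; apply: measurable_funM => //.
  exact: measurable_environment.
have := resolvent_identity_quadratic eps_ge0 lam_gt0 nuE mg gC.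
have -> : (fun w => g (w, 0)) = (fun=> 0).
  by apply/funext => w; rewrite /g /q /position /= expr0n mul0r mulr0 addr0.
rewrite expect_cst mulr0.
have Lg z : lam * g z - L g z = lam * q z + (- (1 + eps) + (- 2) * flux m eps psi z.1).
  have -> : L g z = L q z + 2 * L (fun y => position y * psi y.1) z.
    rewrite /g /walk_generator /generator /opU !big_bool; case: m => /=.
      by rewrite /opT /opTtilde; ring.
    by rewrite /opTtilde; ring.
  rewrite /q walk_generator_sqr walk_generator_product /g /q -psiE; ring.
rewrite (funext Lg) => h.
have bfl := bounded_flux bpsi.
have := bounded_measurable_fst (bounded_measurableD (bounded_measurable_cst (- (1 + eps))) (bounded_measurableZ (- 2) bfl)).
move=> br.
have : lam * expect nu q + expect nu (fun z => - (1 + eps) + (- 2) * flux m eps psi z.1) = 0.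
  rewrite -h [RHS]RintegralD//; last exact: (bounded_measurable_integrable nu br).
    by congr (_ + _); rewrite RintegralZl.
  exact: (integrableZl measurableT lam iq).
rewrite (stationary eps_ge0 hmu lam_gt0 nuE (f := fun w => - (1 + eps) + (- 2) * flux m eps psi w)); last first.
  by apply: bounded_measurableD; [exact: bounded_measurable_cst|exact: bounded_measurableZ].
rewrite expectD; [|exact: bounded_measurable_cst|exact: bounded_measurableZ].
rewrite expect_cst expectZ// expect_flux// => H.
rewrite -[X in (_ * X)%E]fineK; last exact: integrable_fin_num.
rewrite -EFinM -[fine _]/(expect nu q); congr EFin; lra.
Qed.

End second_moment_formula.

(** * Bounds on the mean-square displacement *)

Lemma ceil_multiple {R : realType} (a : R) : 0 < a -> a <= 1 -> exists n : nat, 1 <= a * n%:R <= 2.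
Proof.
move=> a0 a1; exists (Num.trunc a^-1).+1.
have ai : 0 <= a^-1 by rewrite invr_ge0 ltW.
have /andP[h1 h2] := truncn_itv ai.
have e1 : a * a^-1 = 1 by rewrite mulfV// gt_eqF.
apply/andP; split; first by rewrite -[leLHS]e1; apply: ler_wpM2l; exact: ltW.
by rewrite -natr1 mulrDr mulr1; have := ler_wpM2l (ltW a0) h1; lra.
Qed.

Section diffusivity.
Context {R : realType}.
Variables (m : model) (eps : R) (eps_gt0 : 0 < eps).

Definition lower_const : R := 6^-1 / (16 + 36 * trace_const eps + 2 * eps).

Definition upper_const : R := 1 + eps + 3 * trace_const eps + 2 / eps.

Lemma lower_const_gt0 : 0 < lower_const.
Proof.
apply: divr_gt0; first by rewrite invr_gt0.
by have := trace_const_gt0 eps_gt0; have := eps_gt0; lra.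
Qed.

Lemma upper_const_gt0 : 0 < upper_const.
Proof.
have e2 : 0 < 2 / eps by rewrite divr_gt0.
by have := trace_const_gt0 eps_gt0; have := eps_gt0; rewrite /upper_const; lra.
Qed.

Variables (mu : probability config R) (hmu : iid_uniform mu id).

(** The second model is [upper_bound] and [lower_bound]; in the first one the drift is
    split as phi + (e_* - phi).  The condition on s makes the error 3 / eps of
    [hand_bound] negligible compared with the lower bound of order 1 / s. *)
Lemma drift_bounds (s : R) : 0 < s -> s <= 1 -> s <= lower_const * eps / 3 ->
  exists psi : config -> R, [/\ bounded_measurable psi,
    forall w, s ^+ 4 * psi w - env_generator m eps psi w = drift m w &
    let Y := 1 + eps + 2 * expect mu (fun w => backward_drift m w * psi w) in
    lower_const <= s * Y /\ s ^+ 2 * Y <= upper_const].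
Proof.
move=> s0 s1 sc.
have K0 := trace_const_gt0 eps_gt0.
have lam0 : 0 < s ^+ 4 by rewrite exprn_gt0.
(* n of order s^-2 is the number of translates in the trace inequality, and l of
   order s^-3 the size of the test vector. *)
have [n hn] := ceil_multiple (exprn_gt0 2 s0) (exprn_ile1 2 (ltW s0) s1).
have [l hl] := ceil_multiple (exprn_gt0 3 s0) (exprn_ile1 3 (ltW s0) s1).
pose V := config_space hmu.
have res (F : V) : exists psi : V,
    s ^+ 4 *: psi - gen_op (if m is M2 then true else false) eps psi = F.
  have [psi psiE] := env_resolvent m (ltW eps_gt0) (F : bdm_fun R config) lam0.
  exists psi; apply: bdm_ext => w; rewrite -psiE -(gen_op_config_space (hmu := hmu)); by [].
have eqn (psi F : V) : s ^+ 4 *: psi - gen_op (if m is M2 then true else false) eps psi = F ->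
    forall w, s ^+ 4 * (psi : bdm_fun R config) w - env_generator m eps (psi : bdm_fun R config) w
      = (F : bdm_fun R config) w.
  by move=> <- w; rewrite -(gen_op_config_space (hmu := hmu)).
have [psi1 h1] := res (avg (ar V (Some 0))).
have [Q0 sQ] := upper_bound eps_gt0 (ltW s0) hn h1.
have Qs := lower_bound eps_gt0 (ltW s0) s1 hn s0 hl h1.
set Q := ip _ psi1 in Q0 sQ Qs.
have {}Qs : 2 * lower_const <= s * Q.
  have d0 : 0 < 16 + 36 * trace_const eps + 2 * eps by have := eps_gt0; lra.
  rewrite /lower_const mulrA ler_pdivrMr//; move: Qs; move: (16 + _) d0 => d d0; lra.
have s2 : s ^+ 2 <= 1 by exact: exprn_ile1 (ltW s0) s1.
have s20 : 0 <= s ^+ 2 by exact: sqr_ge0.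
have e1 : 0 < eps^-1 by rewrite invr_gt0.
have c0 := lower_const_gt0.
have es : 0 <= (1 - s ^+ 2) * eps by rewrite mulr_ge0 ?(ltW eps_gt0)// subr_ge0.
have eis : 0 <= (1 - s ^+ 2) * eps^-1 by rewrite mulr_ge0 ?(ltW e1)// subr_ge0.
have se : 0 < s * eps by rewrite mulr_gt0.
case: m h1 res eqn => h1 res eqn.
- have [psi2 h2] := res (ar V None - avg (ar V (Some 0))).
  have genD (f g : config -> R) w : env_generator M1 eps (fun y => f y + g y) w =
      env_generator M1 eps f w + env_generator M1 eps g w.
    by rewrite /env_generator /generator /opU !big_bool /= /opT /opTtilde; ring.
  have /andP[X1 X2] := hand_bound eps_gt0 (ltW lam0) h1 h2.
  exists (psi1 + psi2 : bdm_fun R config); split; first exact: bdm_funP.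
    apply: (eqn (psi1 + psi2) (ar V None)).
    have -> : gen_op false eps (psi1 + psi2) = gen_op false eps psi1 + gen_op false eps psi2.
      apply: bdm_ext => w; rewrite [RHS]/= (gen_op_config_space (hmu := hmu) M1).
      rewrite -[RHS]/((gen_op false eps psi1 : bdm_fun R config) w + (gen_op false eps psi2 : bdm_fun R config) w).
      rewrite !(gen_op_config_space (hmu := hmu) M1); exact: genD.
    by rewrite scalerDr opprD addrACA h1 h2 addrC subrK.
  rewrite -[expect _ _]/(ip (ar V (Some 0)) (psi1 + psi2)).
  rewrite -/Q in X1 X2; move: (ip _ (psi1 + psi2)) X1 X2 => X X1 X2.
  rewrite invfM in X1.
  have Xs := ler_wpM2l (ltW s0) X1; have Xs2 := ler_wpM2l s20 X2.
  have sc' : 3 * s * eps^-1 <= lower_const.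
    by rewrite -ler_pdivlMr// invrK; move: sc; lra.
  split; last by rewrite /upper_const; lra.
  by rewrite -mulrA in sc'; lra.
- exists (psi1 : bdm_fun R config); split; first exact: bdm_funP.
    move=> w; rewrite (eqn _ _ h1) avgE /drift addrC; by [].
  have -> : expect mu (fun w => backward_drift M2 w * (psi1 : bdm_fun R config) w) = Q.
    rewrite /Q avgE; congr (expect mu _); apply/funext => w.
    by rewrite /backward_drift addrC.
  by split; [lra|rewrite /upper_const; lra].
Qed.

End diffusivity.

Section laplace_transform.
Context {R : realType}.
Variables (m : model) (eps : R) (eps_gt0 : 0 < eps).
Context {d : measure_display} {T : measurableType d} (P : probability T R).
Variables (eta : R -> T -> config) (X : R -> T -> int).
Hypothesis walk : walk_process P m eps eta X.

(** The integral of E(t) exp (- lam t) is the second moment at an exponential time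
    divided by lam. *)
Lemma laplace_msd_formula (lam : R) : 0 < lam ->
  exists2 mu : probability config R, iid_uniform mu id &
  forall psi : config -> R, bounded_measurable psi ->
    (forall w, lam * psi w - env_generator m eps psi w = drift m w) ->
  laplace_msd P X lam =
    (lam ^- 2 * (1 + eps + 2 * expect mu (fun w => backward_drift m w * psi w)))%:E.
Proof.
move=> lam0; have [iid X0 [mZ pZ [p [_ genL markov]]]] := walk.
have eps0 := ltW eps_gt0.
have LD (g : config * int -> R) c z : walk_generator m eps (fun y => g y + c) z = walk_generator m eps g z.
  by rewrite /walk_generator /generator /opU !big_bool /=; case: m; rewrite /opT /opTtilde; field.
have [nu [nuE nuL]] := resolvent_identity mZ pZ markov genL (bounded_walk_generator m eps0) LD lam0.
have meta : measurable_fun setT (eta 0) by exact: (measurableT_comp measurable_fst (mZ 0 (lexx _))).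
pose eta0 : {mfun T >-> config} := HB.pack (eta 0) (isMeasurableFun.Build _ _ _ _ _ meta).
have hmu : iid_uniform (distribution P eta0) id by [].
exists (distribution P eta0) => // psi bpsi psiE.
have nuL' g : bounded_measurable g -> expect nu (fun z => lam * g z - walk_generator m eps g z)
    = lam * expect (distribution P eta0) (fun w => g (w, 0)).
  move=> bg; rewrite nuL//; congr (_ * _).
  have bg0 : bounded_measurable (fun w => g (w, 0)).
    case: bg => mg [M gM]; split; last by exists M.
    apply: (measurableT_comp mg); apply/measurable_fun_pairP.
    by split; [exact: measurable_id | exact: measurable_cst].
  rewrite /expect /Rintegral; congr fine; rewrite integral_distribution//.
  - by apply: eq_integral => w _ /=; rewrite X0.
  - by apply/measurable_EFinP; case: bg0.
  - apply: bounded_measurable_integrable; case: bg0 => mg [M gM]; split; last by exists M.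
    exact: (measurableT_comp mg meta).
have := second_moment_formula eps0 hmu lam0 nuL' bpsi psiE.
set Y := 1 + eps + _ => hY.
have mq : measurable_fun setT (fun z : config * int => position z ^+ 2 : R).
  exact: (measurable_position (fun x : int => x%:~R ^+ 2 : R)).
have -> : laplace_msd P X lam = (lam^-1%:E * \int[nu]_z (position z ^+ 2)%:E)%E.
  have li0 : 0 <= lam^-1 by rewrite invr_ge0 ltW.
  rewrite -ge0_integralZl//; last 2 first.
  - exact/measurable_EFinP.
  - by move=> z _; rewrite lee_fin sqr_ge0.
  under [RHS]eq_integral do rewrite -EFinM.
  rewrite (nuE (fun z => lam^-1 * position z ^+ 2)); last 2 first.
  - exact: measurable_funM.
  - by move=> z; rewrite mulr_ge0// sqr_ge0.
  rewrite /laplace_msd; apply: eq_integral => t; rewrite inE/= in_itv/= andbT => t0.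
  under [in RHS]eq_integral do rewrite EFinM.
  rewrite ge0_integralZl//; last 2 first.
  - by apply/measurable_EFinP; exact: measurableT_comp mq (mZ t t0).
  - by move=> w _; rewrite lee_fin sqr_ge0.
  rewrite [(lam^-1%:E * _)%E]muleC -muleA -EFinM mulrA mulVf ?mul1r ?gt_eqF//; congr (_ * _)%E.
  rewrite /mean_square_displacement unlock; apply: eq_integral => w _.
  by rewrite /position /= rmorphXn/= intr_norm real_normK ?num_real.
have lamV : lam^-1 * lam = 1 by rewrite mulVf// gt_eqF.
set I := (\int[nu]_z _)%E in hY *.
have -> : I = (lam^-1 * Y)%:E by rewrite EFinM -hY muleA -EFinM lamV mul1e.
by rewrite -EFinM mulrA -invfM -expr2.
Qed.

End laplace_transform.

Theorem theorem1p7 (R : realType) (eps : R) (eps_gt0 : 0 < eps) (m : model) :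
  exists C D : R, [/\ 0 < C, 0 < D &
    \forall lam \near 0^'+,
      forall (d : measure_display) (T : measurableType d)
             (P : probability T R)
             (eta : R -> T -> config) (X : R -> T -> int),
        walk_process P m eps eta X ->
        ((C * lam `^ (- (9 / 4)))%:E <= laplace_msd P X lam)%E /\
        (laplace_msd P X lam <= (D * lam `^ (- (5 / 2)))%:E)%E].
Proof.
have c0 := lower_const_gt0 eps_gt0.
exists (lower_const eps), (upper_const eps); split => //; first exact: upper_const_gt0.
pose s1 := Num.min 1 (lower_const eps * eps / 3).
have s10 : 0 < s1 by rewrite lt_min ltr01 divr_gt0// mulr_gt0.
near=> lam => d T P eta X walk.
have lam0 : 0 < lam by near: lam; exact: nbhs_right_gt.
pose s := lam `^ 4^-1.
have s0 : 0 < s by rewrite powR_gt0.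
have s4 : s ^+ 4 = lam by rewrite -powR_mulrn ?(ltW s0)// -powRrM mulVf// powRr1// ltW.
have pow (n : nat) : lam `^ (- (n%:R / 4)) = s ^- n.
  by rewrite mulrC -mulrN powRrM powRN powR_mulrn// ltW.
have ss1 : s <= s1.
  rewrite -(@ler_pXn2r _ 4) ?nnegrE ?(ltW s0) ?(ltW s10)// s4.
  by near: lam; apply: nbhs_right_le; exact: exprn_gt0.
move: ss1; rewrite le_min => /andP[ss1 ss2].
have [mu hmu formula] := laplace_msd_formula eps_gt0 walk lam0.
have [psi [bpsi psiE [lo hi]]] := drift_bounds m eps_gt0 hmu s0 ss1 ss2.
rewrite s4 in psiE; rewrite (formula psi bpsi psiE) !lee_fin.
set Y := 1 + eps + _ in lo hi *.
have -> : lam `^ (- (9 / 4)) = s ^- 9 by exact: pow 9%N.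
have -> : lam `^ (- (5 / 2)) = s ^- 10 by rewrite -(pow 10%N); congr (_ `^ (- _)); field.
have sn0 := lt0r_neq0 s0.
rewrite -s4; have -> : (s ^+ 4) ^- 2 * Y = s ^- 9 * (s * Y) by field.
split; first by rewrite mulrC ler_wpM2l// invr_ge0 exprn_ge0// ltW.
have -> : s ^- 9 * (s * Y) = s ^- 10 * (s ^+ 2 * Y) by field.
by rewrite [leRHS]mulrC ler_wpM2l// invr_ge0 exprn_ge0// ltW.
Unshelve. all: by end_near. Qed.
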